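(* Let $X,Y$ be real nonzero Banach spaces, $S:X\rightrightarrows X^*$ and $T:Y\rightrightarrows Y^*$ maximal monotone operators of Gossez type (D) with strong representative functions $h_S,h_T$, and $A:X\to Y$ linear continuous with $\big(\operatorname{dom}h_T\times\operatorname{pr}_{X^*}(\operatorname{dom}h_S)\big)\cap\big(\operatorname{im}A\times\Delta_{Y^*}^{A^*}\big)\neq\emptyset$. Then $${}^{ic}\big(G(T)\times R(S)-\operatorname{im}A\times\Delta_{Y^*}^{A^*}\big)\subseteq{}^{ic}\big(\operatorname{co}G(T)\times\operatorname{co}R(S)-\operatorname{im}A\times\Delta_{Y^*}^{A^*}\big)\subseteq{}^{ic}\big(\operatorname{dom}h_T\times\operatorname{pr}_{X^*}(\operatorname{dom}h_S)-\operatorname{im}A\times\Delta_{Y^*}^{A^*}\big)=\operatorname{ri}\big(\operatorname{dom}h_T\times\operatorname{pr}_{X^*}(\operatorname{dom}h_S)-\operatorname{im}A\times\Delta_{Y^*}^{A^*}\big).$$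
   Context: $G(M)$, $R(M)$ are graph and range of an operator; $\operatorname{co}$ is convex hull. Coupling $c(x,x^* )=\langle x^*,x\rangle$; $X$ identified with its image in $X^{**}$. Conjugate of $h$ on $X\times X^*$: $h^*(x^*,x^{**})=\sup_{(x,y^* )}\{\langle x^*,x\rangle+\langle x^{**},y^*\rangle-h(x,y^* )\}$. A representative function of a monotone $S$ is a convex norm-lsc $h_S$ with $h_S\ge c$ and $G(S)\subseteq\{h_S=c\}$; strong if $h_S^*(x^*,x^{**})\ge\langle x^{**},x^*\rangle$ for all. Gossez's closure $\overline S$ has graph $\{(x^{**},x^* )\in X^{**}\times X^*:\langle x^{**}-y,x^*-y^*\rangle\ge0\ \forall(y,y^* )\in G(S)\}$; maximal monotone $S$ is of Gossez type (D) if each point of $G(\overline S)$ is the $w^*\times\|\cdot\|_*$-limit of a bounded net in $G(S)$. $\operatorname{im}A=A(X)$; $\Delta_{Y^*}^{A^*}=\{(y^*,A^*y^* ):y^*\in Y^*\}$; sets are in $Y\times Y^*\times X^*$. For a set $D$: $\operatorname{icr}D=\{u:\forall x\in\operatorname{aff}(D-D)\ \exists\delta>0\ \forall\lambda\in[0,\delta]:u+\lambda x\in D\}$; ${}^{ic}D=\operatorname{icr}D$ if $\operatorname{aff}D$ is closed, else $\emptyset$; $\operatorname{ri}D$ is the interior of $D$ relative to $\operatorname{aff}D$ if $\operatorname{aff}D$ is closed, else $\emptyset$. *)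

(* Defs.v *)
From Stdlib Require Import Reals List Classical.
Open Scope R_scope.

Record NormedSpace := {
  ns_car :> Type;
  ns_zero : ns_car;
  ns_add : ns_car -> ns_car -> ns_car;
  ns_opp : ns_car -> ns_car;
  ns_scal : R -> ns_car -> ns_car;
  ns_norm : ns_car -> R;
  ns_add_assoc : forall x y z, ns_add x (ns_add y z) = ns_add (ns_add x y) z;
  ns_add_comm : forall x y, ns_add x y = ns_add y x;
  ns_add_0 : forall x, ns_add x ns_zero = x;
  ns_add_opp : forall x, ns_add x (ns_opp x) = ns_zero;
  ns_scal_assoc : forall a b x, ns_scal a (ns_scal b x) = ns_scal (a * b) x;
  ns_scal_1 : forall x, ns_scal 1 x = x;
  ns_scal_distr_l : forall a x y,
      ns_scal a (ns_add x y) = ns_add (ns_scal a x) (ns_scal a y);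
  ns_scal_distr_r : forall a b x,
      ns_scal (a + b) x = ns_add (ns_scal a x) (ns_scal b x);
  ns_norm_eq0 : forall x, ns_norm x = 0 -> x = ns_zero;
  ns_norm_scal : forall a x, ns_norm (ns_scal a x) = Rabs a * ns_norm x;
  ns_norm_triangle : forall x y, ns_norm (ns_add x y) <= ns_norm x + ns_norm y
}.

Arguments ns_zero {_}.
Arguments ns_add {_} _ _.
Arguments ns_opp {_} _.
Arguments ns_scal {_} _ _.
Arguments ns_norm {_} _.

Definition ns_sub {X : NormedSpace} (x y : X) : X := ns_add x (ns_opp y).

Definition is_Banach (X : NormedSpace) : Prop :=
  forall u : nat -> X,
    (forall eps, 0 < eps -> exists N, forall n m, (N <= n)%nat -> (N <= m)%nat ->
        ns_norm (ns_sub (u n) (u m)) < eps) ->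
    exists l : X, forall eps, 0 < eps -> exists N, forall n, (N <= n)%nat ->
        ns_norm (ns_sub (u n) l) < eps.

Definition nonzero_space (X : NormedSpace) : Prop := exists x : X, x <> ns_zero.

Definition is_bounded_linear_map {X Y : NormedSpace} (A : X -> Y) : Prop :=
  (forall x y, A (ns_add x y) = ns_add (A x) (A y)) /\
  (forall a x, A (ns_scal a x) = ns_scal a (A x)) /\
  (exists M, forall x, ns_norm (A x) <= M * ns_norm x).

Definition dual_le {X : NormedSpace} (f : X -> R) (c : R) : Prop :=
  forall x, Rabs (f x) <= c * ns_norm x.
Definition dual_lt {X : NormedSpace} (f : X -> R) (eps : R) : Prop :=
  exists c, c < eps /\ dual_le f c.

Definition is_dual {X : NormedSpace} (f : X -> R) : Prop :=
  (forall x y, f (ns_add x y) = f x + f y) /\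
  (forall a x, f (ns_scal a x) = a * f x) /\
  (exists M, dual_le f M).

Definition dsub {X : NormedSpace} (f g : X -> R) : X -> R := fun x => f x - g x.

(* bidual X^** : continuous linear functionals on X^* (values off X^* irrelevant);
   X is embedded via x |-> (fun f => f x). *)
Definition is_bidual {X : NormedSpace} (phi : (X -> R) -> R) : Prop :=
  (forall f g, is_dual f -> is_dual g -> phi (fun x => f x + g x) = phi f + phi g) /\
  (forall a f, is_dual f -> phi (fun x => a * f x) = a * phi f) /\
  (exists M, forall f c, is_dual f -> dual_le f c -> Rabs (phi f) <= M * c).

Definition Op (X : NormedSpace) := X -> (X -> R) -> Prop.

Definition is_monotone {X : NormedSpace} (S : Op X) : Prop :=
  (forall x f, S x f -> is_dual f) /\
  (forall x f y g, S x f -> S y g -> 0 <= dsub f g (ns_sub x y)).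

Definition is_maximal_monotone {X : NormedSpace} (S : Op X) : Prop :=
  is_monotone S /\
  (forall x f, is_dual f -> (forall y g, S y g -> 0 <= dsub f g (ns_sub x y)) -> S x f).

(* (xss, f) in the graph of Gossez's closure of S:
   <xss - y, f - g> = xss(f - g) - (f - g)(y) >= 0 for all (y, g) in G(S) *)
Definition gossez_closure {X : NormedSpace} (S : Op X)
  (xss : (X -> R) -> R) (f : X -> R) : Prop :=
  forall y g, S y g -> 0 <= xss (dsub f g) - dsub f g y.

(* maximal monotone of Gossez type (D): every point of G(closure S) is the
   w* x ||.||_* limit of a bounded net in G(S) *)
Definition is_gossez_D {X : NormedSpace} (S : Op X) : Prop :=
  is_maximal_monotone S /\
  forall xss f, is_bidual xss -> is_dual f -> gossez_closure S xss f ->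
    exists (I : Type) (le : I -> I -> Prop) (xi : I -> X) (fi : I -> X -> R),
      (exists i : I, True) /\
      (forall i, le i i) /\
      (forall i j k, le i j -> le j k -> le i k) /\
      (forall i j, exists k, le i k /\ le j k) /\
      (forall i, S (xi i) (fi i)) /\
      (exists M, forall i, ns_norm (xi i) <= M /\ dual_le (fi i) M) /\
      (forall g, is_dual g -> forall eps, 0 < eps ->
         exists i0, forall i, le i0 i -> Rabs (g (xi i) - xss g) < eps) /\
      (forall eps, 0 < eps ->
         exists i0, forall i, le i0 i -> dual_le (dsub (fi i) f) eps).

Inductive Rinf := Fin (r : R) | PInf.

Definition Rinf_le (a b : Rinf) : Prop :=
  match b with
  | PInf => True
  | Fin rb => match a with Fin ra => ra <= rb | PInf => False end
  end.

Definition is_convex_fun {X : NormedSpace} (h : X -> (X -> R) -> Rinf) : Prop :=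
  forall x1 f1 x2 f2 t, is_dual f1 -> is_dual f2 -> 0 < t < 1 ->
    match h x1 f1, h x2 f2 with
    | Fin a, Fin b =>
        Rinf_le (h (ns_add (ns_scal t x1) (ns_scal (1 - t) x2))
                   (fun z => t * f1 z + (1 - t) * f2 z))
                (Fin (t * a + (1 - t) * b))
    | _, _ => True
    end.

(* norm-lower semicontinuity on X x X^*: all sublevel sets are norm closed *)
Definition is_norm_lsc {X : NormedSpace} (h : X -> (X -> R) -> Rinf) : Prop :=
  forall (r : R) (u : nat -> X) (v : nat -> X -> R) (x : X) (f : X -> R),
    is_dual f -> (forall n, is_dual (v n)) ->
    (forall n, Rinf_le (h (u n) (v n)) (Fin r)) ->
    (forall eps, 0 < eps -> exists N, forall n, (N <= n)%nat ->
        ns_norm (ns_sub (u n) x) < eps /\ dual_lt (dsub (v n) f) eps) ->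
    Rinf_le (h x f) (Fin r).

Definition is_representative {X : NormedSpace} (S : Op X)
  (h : X -> (X -> R) -> Rinf) : Prop :=
  is_convex_fun h /\ is_norm_lsc h /\
  (forall x f, is_dual f -> Rinf_le (Fin (f x)) (h x f)) /\
  (forall x f, S x f -> h x f = Fin (f x)).

(* conj h (f, xss) >= a, where
   conj h (f, xss) = sup over (x, g) in X x X^dual of  f(x) + xss(g) - h(x, g) *)
Definition conj_ge {X : NormedSpace} (h : X -> (X -> R) -> Rinf)
  (f : X -> R) (xss : (X -> R) -> R) (a : R) : Prop :=
  forall b, b < a -> exists x g r, is_dual g /\ h x g = Fin r /\
    b < f x + xss g - r.

Definition is_strong_representative {X : NormedSpace} (S : Op X)
  (h : X -> (X -> R) -> Rinf) : Prop :=
  is_representative S h /\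
  forall f xss, is_dual f -> is_bidual xss -> conj_ge h f xss (xss f).

Record VOps := {
  vcar :> Type;
  vzero : vcar;
  vadd : vcar -> vcar -> vcar;
  vscal : R -> vcar -> vcar }.
Arguments vzero {_}.
Arguments vadd {_} _ _.
Arguments vscal {_} _ _.

Definition nsV (X : NormedSpace) : VOps :=
  {| vcar := X; vzero := ns_zero; vadd := ns_add; vscal := ns_scal |}.
Definition dualV (X : NormedSpace) : VOps :=
  {| vcar := X -> R; vzero := fun _ => 0;
     vadd := fun f g x => f x + g x; vscal := fun a f x => a * f x |}.
Definition prodV (V W : VOps) : VOps :=
  {| vcar := (vcar V * vcar W)%type; vzero := (vzero, vzero);
     vadd := fun p q => (vadd (fst p) (fst q), vadd (snd p) (snd q));
     vscal := fun a p => (vscal a (fst p), vscal a (snd p)) |}.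

Definition lincomb {V : VOps} (l : list (R * vcar V)) : vcar V :=
  fold_right (fun p acc => vadd (vscal (fst p) (snd p)) acc) vzero l.
Definition coefsum {V : VOps} (l : list (R * vcar V)) : R :=
  fold_right (fun p acc => fst p + acc) 0 l.

Definition co {V : VOps} (D : vcar V -> Prop) : vcar V -> Prop :=
  fun z => exists l : list (R * vcar V),
    Forall (fun p => 0 <= fst p /\ D (snd p)) l /\ coefsum l = 1 /\ z = lincomb l.
Definition aff {V : VOps} (D : vcar V -> Prop) : vcar V -> Prop :=
  fun z => exists l : list (R * vcar V),
    Forall (fun p => D (snd p)) l /\ coefsum l = 1 /\ z = lincomb l.
Definition setsub {V : VOps} (D1 D2 : vcar V -> Prop) : vcar V -> Prop :=
  fun z => exists a b, D1 a /\ D2 b /\ z = vadd a (vscal (-1) b).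
Definition icr {V : VOps} (D : vcar V -> Prop) : vcar V -> Prop :=
  fun u => forall x, aff (setsub D D) x ->
    exists delta, 0 < delta /\
      forall lam, 0 <= lam <= delta -> D (vadd u (vscal lam x)).

Definition Zsp (X Y : NormedSpace) : VOps :=
  prodV (prodV (nsV Y) (dualV Y)) (dualV X).

Definition inZ {X Y : NormedSpace} (z : vcar (Zsp X Y)) : Prop :=
  is_dual (snd (fst z)) /\ is_dual (snd z).
Definition Z_norm_lt {X Y : NormedSpace} (z : vcar (Zsp X Y)) (eps : R) : Prop :=
  ns_norm (fst (fst z)) < eps /\ dual_lt (snd (fst z)) eps /\ dual_lt (snd z) eps.
Definition Zsub {X Y : NormedSpace} (a b : vcar (Zsp X Y)) : vcar (Zsp X Y) :=
  vadd a (vscal (-1) b).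
Definition Z_closed {X Y : NormedSpace} (D : vcar (Zsp X Y) -> Prop) : Prop :=
  forall (u : nat -> vcar (Zsp X Y)) (z : vcar (Zsp X Y)),
    (forall n, D (u n)) -> inZ z ->
    (forall eps, 0 < eps -> exists N, forall n, (N <= n)%nat ->
        Z_norm_lt (Zsub (u n) z) eps) ->
    D z.

Definition ic {X Y : NormedSpace} (D : vcar (Zsp X Y) -> Prop) : vcar (Zsp X Y) -> Prop :=
  fun u => Z_closed (aff D) /\ icr D u.
Definition ri {X Y : NormedSpace} (D : vcar (Zsp X Y) -> Prop) : vcar (Zsp X Y) -> Prop :=
  fun u => Z_closed (aff D) /\ D u /\
    exists eps, 0 < eps /\ forall w, inZ w -> aff D w -> Z_norm_lt (Zsub w u) eps -> D w.

Definition imA_Delta {X Y : NormedSpace} (A : X -> Y) : vcar (Zsp X Y) -> Prop :=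
  fun z => exists (x : X) (g : Y -> R), is_dual g /\ z = ((A x, g), fun x' => g (A x')).

Definition GT_RS {X Y : NormedSpace} (S : Op X) (T : Op Y) : vcar (Zsp X Y) -> Prop :=
  fun z => exists (y : Y) (g : Y -> R) (f : X -> R),
    T y g /\ (exists x, S x f) /\ z = ((y, g), f).

Definition coGT_coRS {X Y : NormedSpace} (S : Op X) (T : Op Y) : vcar (Zsp X Y) -> Prop :=
  fun z => exists (p : vcar (prodV (nsV Y) (dualV Y))) (f : vcar (dualV X)),
    co (V := prodV (nsV Y) (dualV Y)) (fun q => T (fst q) (snd q)) p /\
    co (V := dualV X) (fun f' => exists x, S x f') f /\
    z = (p, f).

Definition domT_prS {X Y : NormedSpace} (hS : X -> (X -> R) -> Rinf)
  (hT : Y -> (Y -> R) -> Rinf) : vcar (Zsp X Y) -> Prop :=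
  fun z => exists (y : Y) (g : Y -> R) (f : X -> R),
    is_dual g /\ is_dual f /\ (exists r, hT y g = Fin r) /\
    (exists x r, hS x f = Fin r) /\ z = ((y, g), f).

(* Main.v *)
(* The first inclusion holds because E <= F <= aff E implies ic E <= ic F, and the second
   reduces to dom h_T x pr dom h_S - im A x Delta <= aff (co G(T) x co R(S) - im A x Delta)
   when the right side is closed.  If this fails, Hahn-Banach gives p in the dual of Y, q in
   the bidual of Y and r in the bidual of X such that (p, q, r) vanishes on im A x Delta
   but is constant on the affine hull and not at some point of the left side.  Vanishing on
   im A x Delta means p o A = 0 and q = - r o A^t, so q(p) = 0 and the coupling is affine
   along the direction (q, p).  By type (D) the Fitzpatrick function of T, extended to the
   bidual, stays above the coupling, so moving from a point of dom h_T in both directions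
   shows that (p, q) keeps on dom h_T its constant value on G(T); the same argument applied
   to (0, r) treats h_S.  The equality ic = ri is an open mapping theorem: the last set is a
   linear image of the domain of a convex lsc function on a Banach space, and Baire's
   theorem applies to the images of its bounded sublevel sets. *)

Require Import Defs.
From Stdlib Require Import Reals List Classical ClassicalEpsilon.
From Stdlib Require Import FunctionalExtensionality PropExtensionality Lra Lia.
From mathcomp Require classical_sets.
Open Scope R_scope.

(** * Identities between linear combinations *)

(** Maximal monotonicity tests only points of X x X^*, whereas a separating functional restricted to
    a dual space is an element of a bidual that need not come from the space itself. Type (D) makes
    the coupling inequality available along such directions. The identity q(p) = 0 arises by
    evaluating q = - r o A^t at p itself, whose pullback p o A is zero. Constancy on the product
    G(T) x R(S) splits into constancy on each factor by freezing the other one at a graph point.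

    The inclusion of the co set in the affine hull of the first set is purely algebraic; the second
    hull inclusion rests on separation and therefore on closedness.

    In the open mapping argument, the domain of an lsc function need not be closed, but it is a
    countable increasing union of closed sublevel sets. The projection of such a set to X^* need not
    be closed either, so the projected-out point of X stays as a coordinate of the space on which
    the linear map is defined.

    Dual spaces are represented by all real functions with continuity as a predicate; the analytic
    theorems are therefore stated for vector spaces whose gauge may be finite on a part only. *)

Record VLaws (V : VOps) : Prop := {
  vl_assoc : forall x y z : V, vadd x (vadd y z) = vadd (vadd x y) z;
  vl_comm : forall x y : V, vadd x y = vadd y x;
  vl_zero : forall x : V, vadd x vzero = x;
  vl_scal0 : forall x : V, vscal 0 x = vzero;
  vl_scal_assoc : forall a b (x : V), vscal a (vscal b x) = vscal (a * b) x;
  vl_scal1 : forall x : V, vscal 1 x = x;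
  vl_distr_l : forall a (x y : V), vscal a (vadd x y) = vadd (vscal a x) (vscal a y);
  vl_distr_r : forall a b (x : V), vscal (a + b) x = vadd (vscal a x) (vscal b x) }.

Definition vsub {V : VOps} (x y : V) : V := vadd x (vscal (-1) y).

(** Reflection of linear expressions: an identity between two of them follows from equality of the
    coefficients of each atom. [meqs] is recursive in the number of atoms so that it computes to a
    finite conjunction of real equations, left to [ring] or [field]. *)
Inductive mexp :=
  | MAtom (n : nat)
  | MZero
  | MAdd (a b : mexp)
  | MScal (c : R) (a : mexp).

Section ModuleIdentities.
Context (V : VOps) (HV : VLaws V).

Fixpoint meval (env : list V) (e : mexp) : V :=
  match e with
  | MAtom n => nth n env vzero
  | MZero => vzero
  | MAdd a b => vadd (meval env a) (meval env b)
  | MScal c a => vscal c (meval env a)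
  end.

Fixpoint mcoef (e : mexp) (i : nat) : R :=
  match e with
  | MAtom n => if Nat.eqb n i then 1 else 0
  | MZero => 0
  | MAdd a b => mcoef a i + mcoef b i
  | MScal c a => c * mcoef a i
  end.

Fixpoint mcomb (env : list V) (c : nat -> R) : V :=
  match env with
  | nil => vzero
  | x :: l => vadd (vscal (c 0%nat) x) (mcomb l (fun i => c (S i)))
  end.

Fixpoint meqs (n : nat) (c d : nat -> R) : Prop :=
  match n with
  | O => True
  | S n => c 0%nat = d 0%nat /\ meqs n (fun i => c (S i)) (fun i => d (S i))
  end.

Lemma vl_add0 (x : V) : vadd vzero x = x.
Proof. rewrite (vl_comm _ HV); apply (vl_zero _ HV). Qed.

Lemma vl_scal_zero a : vscal a (vzero : V) = vzero.
Proof.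
  rewrite <- (vl_scal0 _ HV vzero), (vl_scal_assoc _ HV). f_equal; ring.
Qed.

Lemma vl_swap (a b c d : V) : vadd (vadd a b) (vadd c d) = vadd (vadd a c) (vadd b d).
Proof.
  rewrite !(vl_assoc _ HV). f_equal.
  rewrite <- !(vl_assoc _ HV). f_equal. apply (vl_comm _ HV).
Qed.

Lemma mcomb_add env : forall c d,
  mcomb env (fun i => c i + d i) = vadd (mcomb env c) (mcomb env d).
Proof.
  induction env as [|x l IH]; intros c d; simpl.
  - now rewrite vl_add0.
  - rewrite (vl_distr_r _ HV), (IH (fun i => c (S i)) (fun i => d (S i))).
    apply vl_swap.
Qed.

Lemma mcomb_scal env : forall a c,
  mcomb env (fun i => a * c i) = vscal a (mcomb env c).
Proof.
  induction env as [|x l IH]; intros a c; simpl.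
  - now rewrite vl_scal_zero.
  - rewrite (vl_distr_l _ HV), (vl_scal_assoc _ HV), (IH a (fun i => c (S i))).
    reflexivity.
Qed.

Lemma mcomb_zero env : mcomb env (fun _ => 0) = vzero.
Proof.
  induction env as [|x l IH]; simpl; [reflexivity|].
  now rewrite IH, (vl_scal0 _ HV), vl_add0.
Qed.

Lemma mcomb_atom env : forall n,
  mcomb env (fun i => if Nat.eqb n i then 1 else 0) = nth n env vzero.
Proof.
  induction env as [|x l IH]; intros [|n]; simpl; try reflexivity.
  - now rewrite (vl_scal1 _ HV), mcomb_zero, (vl_zero _ HV).
  - now rewrite (vl_scal0 _ HV), vl_add0, <- IH.
Qed.

Lemma meval_mcomb env e : meval env e = mcomb env (mcoef e).
Proof.
  induction e as [n| |a IHa b IHb|c a IHa]; simpl.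
  - now rewrite mcomb_atom.
  - now rewrite mcomb_zero.
  - now rewrite IHa, IHb, mcomb_add.
  - now rewrite IHa, mcomb_scal.
Qed.

Lemma mcomb_ext env : forall c d, meqs (length env) c d -> mcomb env c = mcomb env d.
Proof.
  induction env as [|x l IH]; intros c d H; simpl in *; [reflexivity|].
  destruct H as [H1 H2]. rewrite H1. f_equal. now apply IH.
Qed.

Lemma meval_eq env e1 e2 :
  meqs (length env) (mcoef e1) (mcoef e2) -> meval env e1 = meval env e2.
Proof. intros H. rewrite !meval_mcomb. now apply mcomb_ext. Qed.

End ModuleIdentities.

Ltac mod_insert x env :=
  lazymatch env with
  | context [cons x _] => env
  | _ => constr:(cons x env)
  end.

Ltac mod_atoms t env :=
  lazymatch t with
  | vadd ?a ?b => let env := mod_atoms a env in mod_atoms b env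
  | vsub ?a ?b => let env := mod_atoms a env in mod_atoms b env
  | vscal _ ?a => mod_atoms a env
  | vzero => env
  | _ => mod_insert t env
  end.

Ltac mod_index x env :=
  lazymatch env with
  | cons x _ => constr:(O)
  | cons _ ?l => let n := mod_index x l in constr:(S n)
  end.

Ltac mod_reify t env :=
  lazymatch t with
  | vadd ?a ?b =>
      let a := mod_reify a env in let b := mod_reify b env in constr:(MAdd a b)
  | vsub ?a ?b =>
      let a := mod_reify a env in let b := mod_reify b env in
      constr:(MAdd a (MScal (-1) b))
  | vscal ?c ?a => let a := mod_reify a env in constr:(MScal c a)
  | vzero => constr:(MZero)
  | _ => let n := mod_index t env in constr:(MAtom n)
  end.

Ltac module_with HV :=
  lazymatch type of HV with
  | VLaws ?V =>
    lazymatch goal with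
    | |- ?l = ?r =>
        let env := mod_atoms l constr:(@nil (vcar V)) in
        let env := mod_atoms r env in
        let el := mod_reify l env in
        let er := mod_reify r env in
        change (meval V env el = meval V env er);
        apply (meval_eq V HV); cbn [meqs mcoef length Nat.eqb];
        repeat split
    end
  end.

(** * Affine hulls, convex hulls and relative algebraic interiors *)

Definition subspace {V : VOps} (W : V -> Prop) : Prop :=
  W vzero /\ (forall x y, W x -> W y -> W (vadd x y)) /\
  (forall a x, W x -> W (vscal a x)).

Definition convex_set {V : VOps} (C : V -> Prop) : Prop :=
  forall x y t, C x -> C y -> 0 < t < 1 -> C (vadd (vscal t x) (vscal (1 - t) y)).

Section AffineHulls.
Context {V : VOps} (HV : VLaws V).

Lemma subspace_sub (W : V -> Prop) x y : subspace W -> W x -> W y -> W (vsub x y).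
Proof. intros (_ & Hadd & Hscal) Hx Hy. apply Hadd; auto. Qed.

Lemma subspace_eq (W : V -> Prop) x y : W x -> x = y -> W y.
Proof. now intros H <-. Qed.

Lemma lincomb_app (l l' : list (R * V)) :
  lincomb (l ++ l') = vadd (lincomb l) (lincomb l').
Proof.
  induction l as [|p l IH]; simpl.
  - now rewrite vl_add0.
  - now rewrite IH, (vl_assoc _ HV).
Qed.

Lemma coefsum_app (l l' : list (R * V)) : coefsum (l ++ l') = coefsum l + coefsum l'.
Proof. induction l as [|p l IH]; simpl; [|rewrite IH]; ring. Qed.

Definition lscale (t : R) (l : list (R * V)) : list (R * V) :=
  map (fun p => (t * fst p, snd p)) l.

Lemma lincomb_lscale t (l : list (R * V)) : lincomb (lscale t l) = vscal t (lincomb l).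
Proof.
  induction l as [|p l IH]; simpl.
  - now rewrite vl_scal_zero.
  - rewrite IH. module_with HV; ring.
Qed.

Lemma coefsum_lscale t (l : list (R * V)) : coefsum (lscale t l) = t * coefsum l.
Proof. induction l as [|p l IH]; simpl; [|rewrite IH]; ring. Qed.

Lemma Forall_lscale (P : V -> Prop) t (l : list (R * V)) :
  Forall (fun p => P (snd p)) l -> Forall (fun p => P (snd p)) (lscale t l).
Proof. intros H. induction H; constructor; auto. Qed.

Lemma aff_incl (D : V -> Prop) x : D x -> aff D x.
Proof.
  intros H. exists ((1, x) :: nil); simpl. repeat split.
  - repeat constructor; exact H.
  - ring.
  - module_with HV; ring.
Qed.

Lemma aff_comb (D : V -> Prop) x y t :
  aff D x -> aff D y -> aff D (vadd (vscal t x) (vscal (1 - t) y)).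
Proof.
  intros (l & Hl & Sl & ->) (l' & Hl' & Sl' & ->).
  exists (lscale t l ++ lscale (1 - t) l'). repeat split.
  - apply Forall_app; split; now apply Forall_lscale.
  - rewrite coefsum_app, !coefsum_lscale, Sl, Sl'. ring.
  - now rewrite lincomb_app, !lincomb_lscale.
Qed.

Lemma lincomb_sub_mem (W : V -> Prop) d (l : list (R * V)) : subspace W ->
  Forall (fun p => W (vsub (snd p) d)) l -> W (vsub (lincomb l) (vscal (coefsum l) d)).
Proof.
  intros (W0 & Wadd & Wscal) H. induction H as [|p l Hp Hl IH]; simpl.
  - eapply subspace_eq; [exact W0|]. module_with HV; ring.
  - eapply subspace_eq; [exact (Wadd _ _ (Wscal (fst p) _ Hp) IH)|].
    module_with HV; ring.
Qed.

Lemma aff_sub_mem (W D : V -> Prop) d z : subspace W ->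
  (forall x, D x -> W (vsub x d)) -> aff D z -> W (vsub z d).
Proof.
  intros HW HD (l & Hl & Sl & ->).
  eapply subspace_eq; [apply (lincomb_sub_mem W d l HW)|].
  - eapply Forall_impl; [|exact Hl]. intros p; apply HD.
  - rewrite Sl. module_with HV; ring.
Qed.

(** For [d] in [aff D] this is the linear subspace parallel to the affine hull, which reduces affine
    questions to linear ones. *)
Definition directions (D : V -> Prop) (d : V) : V -> Prop := fun w => aff D (vadd d w).

Lemma directions_subspace (D : V -> Prop) d : aff D d -> subspace (directions D d).
Proof.
  intros Hd. assert (Hs : forall a x, directions D d x -> directions D d (vscal a x)).
  { intros a x Hx. unfold directions in *. eapply subspace_eq; [exact (aff_comb D _ _ a Hx Hd)|].
    module_with HV; ring. }
  split; [|split; [|exact Hs]].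
  - unfold directions. eapply subspace_eq; [exact Hd|]. module_with HV; ring.
  - intros x y Hx Hy. unfold directions.
    (* [d + (x + y)] is the midpoint of [d + 2 x] and [d + 2 y]. *)
    eapply subspace_eq;
      [exact (aff_comb D _ _ (1/2) (Hs 2 _ Hx) (Hs 2 _ Hy))|].
    module_with HV; field.
Qed.

Lemma aff_directions (D : V -> Prop) d z : aff D z <-> directions D d (vsub z d).
Proof.
  unfold directions. replace (vadd d (vsub z d)) with z; [tauto|].
  module_with HV; ring.
Qed.

(** Identifies the directions tested by [icr]: every difference of points of [D] is parallel to
    [aff D], and conversely each parallel direction is an affine combination of differences
    [x - d]. *)
Lemma aff_setsub (D : V -> Prop) d w : D d ->
  aff (setsub D D) w <-> directions D d w.
Proof.
  intros Hd. pose proof (directions_subspace D d (aff_incl D d Hd)) as HW. split.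
  - intros Hw. eapply subspace_eq; [apply (aff_sub_mem _ (setsub D D) vzero w HW)|].
    + intros x (a & b & Ha & Hb & ->).
      eapply subspace_eq; [apply (subspace_sub _ (vsub a d) (vsub b d) HW)|].
      * apply aff_directions; now apply aff_incl.
      * apply aff_directions; now apply aff_incl.
      * module_with HV; ring.
    + exact Hw.
    + module_with HV; ring.
  - intros (l & Hl & Sl & Hw).
    (* The coefficients are kept; since they sum to 1, subtracting [d] from each entry subtracts
       exactly [d] from the combination. *)
    exists (map (fun p => (fst p, vsub (snd p) d)) l). repeat split.
    + clear Sl Hw. induction Hl; constructor; auto.
      exists (snd x), d. auto.
    + rewrite <- Sl. clear -HV. induction l as [|p l IH]; simpl; congruence.
    + replace w with (vsub (lincomb l) (vscal (coefsum l) d)).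
      * clear -HV. induction l as [|p l IH]; simpl.
        -- module_with HV; ring.
        -- rewrite <- IH. module_with HV; ring.
      * rewrite <- Hw, Sl. module_with HV; ring.
Qed.

Lemma aff_subset_aff (D E : V -> Prop) z :
  (forall x, D x -> aff E x) -> aff D z -> aff E z.
Proof.
  intros H Hz. destruct (classic (exists d, D d)) as [[d Hd]|Hn].
  - apply (aff_directions E d). apply (aff_sub_mem _ D d z); auto.
    + apply directions_subspace; auto.
    + intros x Hx. apply aff_directions. auto.
  - destruct Hz as ([|p l] & Hl & Sl & _); simpl in Sl; [lra|].
    inversion Hl; subst. contradiction Hn; eauto.
Qed.

(** Both sets have the same affine hull, hence the same directions to test, and the segments found
    inside [E] lie in [F]. *)
Lemma icr_mono (E F : V -> Prop) z : (exists d, E d) ->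
  (forall x, E x -> F x) -> (forall x, F x -> aff E x) -> icr E z -> icr F z.
Proof.
  intros [d Hd] HEF HFE Hz w Hw.
  destruct (Hz w) as (delta & Hp & Hlam).
  - apply (aff_setsub E d w Hd). apply (aff_setsub F d w (HEF d Hd)) in Hw.
    exact (aff_subset_aff F E _ HFE Hw).
  - exists delta. split; auto.
Qed.

Lemma co_convex_set (D C : V -> Prop) z : convex_set C ->
  (forall x, D x -> C x) -> co D z -> C z.
Proof.
  intros HC HD (l & Hl & Sl & ->).
  (* The tail of a list no longer has coefficient sum 1, so the induction speaks of the normalised
     combination. A zero sum of nonnegative coefficients is kept apart because it cannot be
     normalised. *)
  assert (H : 0 <= coefsum l /\ (coefsum l = 0 -> lincomb l = vzero) /\
    (0 < coefsum l -> C (vscal (/ coefsum l) (lincomb l)))).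
  { clear Sl. induction Hl as [|[a x] l [Ha Hx] Hl IH]; simpl in *.
    - split; [lra|split; [auto|lra]].
    - destruct IH as (I0 & I1 & I2). split; [lra|split].
      + intros Hs. rewrite I1 by lra. replace a with 0 by lra. module_with HV; ring.
      + intros Hs. destruct (Req_dec (coefsum l) 0) as [E|E].
        * rewrite E, I1 by exact E. eapply subspace_eq; [exact (HD x Hx)|].
          module_with HV. field; lra.
        * destruct (Req_dec a 0) as [Ea|Ea].
          -- subst a. eapply subspace_eq; [apply I2; lra|].
             module_with HV; field; lra.
          -- eapply subspace_eq.
             ++ apply (HC x (vscal (/ coefsum l) (lincomb l)) (a / (a + coefsum l)));
                  [auto|apply I2; lra|].
                split; [apply Rdiv_lt_0_compat; lra|].
                apply (Rmult_lt_reg_r (a + coefsum l)); [lra|].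
                unfold Rdiv. rewrite Rmult_assoc, Rinv_l; lra.
             ++ module_with HV; field; lra. }
  destruct H as (_ & _ & H). rewrite Sl in H.
  eapply subspace_eq; [apply H; lra|]. module_with HV; field.
Qed.

Lemma co_incl (D : V -> Prop) x : D x -> co D x.
Proof.
  intros H. exists ((1, x) :: nil); simpl. repeat split.
  - repeat constructor; simpl; auto; lra.
  - ring.
  - module_with HV; ring.
Qed.

Lemma co_aff (D : V -> Prop) x : co D x -> aff D x.
Proof.
  intros (l & Hl & Sl & Hx). exists l. repeat split; auto.
  eapply Forall_impl; [|exact Hl]. now intros p [_ H].
Qed.

End AffineHulls.

(** * Complete gauged spaces and Baire's theorem *)

(* [gN z r] reads: z lies in the normed part of V and its norm is smaller than r.
   In [dualV] only the continuous linear functionals have finite gauge, so duals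
   need neither a subtype nor an operator norm. *)
Record Gauged := {
  gV :> VOps;
  gL : VLaws gV;
  gN : gV -> R -> Prop;
  gN_pos : forall z r, gN z r -> 0 < r;
  gN_mon : forall z r s, gN z r -> r <= s -> gN z s;
  gN_zero : forall r, 0 < r -> gN vzero r;
  gN_add : forall x y r s, gN x r -> gN y s -> gN (vadd x y) (r + s);
  gN_scal : forall t x r, t <> 0 -> gN x r -> gN (vscal t x) (Rabs t * r);
  gN_sep : forall x, (forall r, 0 < r -> gN x r) -> x = vzero;
  gN_complete : forall u : nat -> gV, (forall n, exists r, gN (u n) r) ->
    (forall eps, 0 < eps -> exists N, forall n m, (N <= n)%nat -> (N <= m)%nat ->
       gN (vsub (u n) (u m)) eps) ->
    exists l, (exists r, gN l r) /\
      forall eps, 0 < eps -> exists N, forall n, (N <= n)%nat -> gN (vsub (u n) l) eps }.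

Arguments gN {_} _ _.
Arguments gL _ : clear implicits.

Definition gdom {V : Gauged} (z : V) : Prop := exists r, gN z r.
Definition gcv {V : Gauged} (u : nat -> V) (l : V) : Prop :=
  forall eps, 0 < eps -> exists N, forall n, (N <= n)%nat -> gN (vsub (u n) l) eps.
Definition gclosed {V : Gauged} (D : V -> Prop) : Prop :=
  forall u z, (forall n, D (u n)) -> gdom z -> gcv u z -> D z.

Ltac vmod := match goal with
  | |- @eq (vcar (gV ?V)) _ _ => module_with (gL V)
  end.
Tactic Notation "vmod_ring" := vmod; ring.

Section GaugeBasics.
Context {V : Gauged}.
Implicit Types x y z : V.

Lemma gN_eq x y r : gN x r -> x = y -> gN y r.
Proof. now intros H <-. Qed.

Lemma gN_scal_le t x r s : gN x r -> Rabs t * r <= s -> 0 < s -> gN (vscal t x) s.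
Proof.
  intros Hx Hle Hs. destruct (Req_dec t 0) as [->|Ht].
  - apply (gN_eq vzero); [now apply gN_zero|]. vmod_ring.
  - eapply gN_mon; [apply gN_scal; eassumption|assumption].
Qed.

Lemma gN_sub x y r s : gN x r -> gN y s -> gN (vsub x y) (r + s).
Proof.
  intros Hx Hy. apply gN_add; auto.
  pose proof (gN_pos _ _ _ Hy). eapply gN_scal_le; [exact Hy| |lra].
  rewrite Rabs_left; lra.
Qed.

Lemma gN_sub_swap x y r : gN (vsub x y) r -> gN (vsub y x) r.
Proof.
  intros H. pose proof (gN_pos _ _ _ H).
  apply (gN_eq (vscal (-1) (vsub x y))); [|vmod_ring].
  eapply gN_scal_le; [exact H| |lra]. rewrite Rabs_left; lra.
Qed.

Lemma gN_sub_trans x y z r s : gN (vsub x y) r -> gN (vsub y z) s -> gN (vsub x z) (r + s).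
Proof.
  intros H1 H2. apply (gN_eq (vadd (vsub x y) (vsub y z))); [now apply gN_add|].
  vmod_ring.
Qed.

Lemma gdom_subspace : subspace (@gdom V).
Proof.
  split; [|split].
  - exists 1. apply gN_zero; lra.
  - intros x y [r Hr] [s Hs]. exists (r + s). now apply gN_add.
  - intros a x [r Hr]. exists (Rabs a * r + 1). pose proof (gN_pos _ _ _ Hr).
    eapply gN_scal_le; [exact Hr|lra|].
    pose proof (Rabs_pos a). nra.
Qed.

Lemma gcv_unique (u : nat -> V) x y : gcv u x -> gcv u y -> x = y.
Proof.
  intros Hx Hy.
  assert (E : vsub x y = vzero).
  { apply gN_sep. intros r Hr.
    destruct (Hx (r/2)) as [N1 H1]; [lra|]. destruct (Hy (r/2)) as [N2 H2]; [lra|].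
    replace r with (r/2 + r/2) by field.
    apply (gN_sub_trans _ (u (N1 + N2)%nat)).
    - apply gN_sub_swap, H1; lia.
    - apply H2; lia. }
  replace x with (vadd y (vsub x y)); [|vmod_ring].
  rewrite E. vmod_ring.
Qed.

Lemma pow_half_small K eps : 0 < eps -> exists N, forall n, (N <= n)%nat -> K * (/2)^n < eps.
Proof.
  intros He. destruct (pow_lt_1_zero (/2)) with (y := eps / (Rabs K + 1)) as [N HN].
  - rewrite Rabs_pos_eq; lra.
  - apply Rdiv_lt_0_compat; [lra|]. pose proof (Rabs_pos K); lra.
  - exists N. intros n Hn. specialize (HN n Hn).
    assert (0 < (/2)^n) by (apply pow_lt; lra).
    rewrite Rabs_pos_eq in HN by lra.
    apply Rle_lt_trans with (Rabs K * (/2)^n).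
    + apply Rmult_le_compat_r; [lra|apply Rle_abs].
    + pose proof (Rabs_pos K).
      apply (Rmult_lt_compat_l (Rabs K + 1)) in HN; [|lra].
      unfold Rdiv in HN. rewrite (Rmult_comm eps), <- Rmult_assoc, Rinv_r in HN by lra.
      lra.
Qed.

Lemma geometric_cauchy (u : nat -> V) K :
  (forall n, gN (vsub (u (S n)) (u n)) (K * (/2)^n)) ->
  forall n p, gN (vsub (u (n + p)%nat) (u n)) (3 * K * (/2)^n).
Proof.
  intros H n p.
  assert (HK : 0 < K) by (pose proof (gN_pos _ _ _ (H O)) as H0; simpl in H0; lra).
  assert (Hn : forall m, 0 < (/2)^m) by (intros m; apply pow_lt; lra).
  (* The subtracted term absorbs the next step exactly, which closes the induction; the factor 3
     rather than 2 keeps the radius positive at [p = 0]. *)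
  assert (G : gN (vsub (u (n + p)%nat) (u n)) (3 * K * (/2)^n - 2 * (K * (/2)^(n + p)))).
  { induction p as [|p IH].
    - rewrite Nat.add_0_r. apply (gN_eq vzero); [apply gN_zero|vmod_ring].
      specialize (Hn n). nra.
    - rewrite Nat.add_succ_r.
      eapply gN_mon; [eapply gN_sub_trans; [apply H|exact IH]|].
      simpl. lra. }
  eapply gN_mon; [exact G|]. specialize (Hn (n + p)%nat). nra.
Qed.

Lemma geometric_cv (u : nat -> V) K : gdom (u O) ->
  (forall n, gN (vsub (u (S n)) (u n)) (K * (/2)^n)) ->
  exists l, gdom l /\ gcv u l.
Proof.
  intros H0 H. pose proof (geometric_cauchy u K H) as G.
  apply gN_complete.
  - intros n. destruct H0 as [r Hr]. exists (3 * K * (/2)^0 + r).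
    apply (gN_eq (vadd (vsub (u (0 + n)%nat) (u O)) (u O))); [now apply gN_add|].
    simpl. vmod_ring.
  - intros eps He. destruct (pow_half_small (6 * K) eps He) as [N HN].
    exists N. intros n m Hn Hm. specialize (HN N (le_n N)).
    apply (gN_mon _ _ (3 * K * (/2)^N + 3 * K * (/2)^N)); [|lra].
    apply (gN_sub_trans _ (u N)).
    + replace n with (N + (n - N))%nat by lia. apply G.
    + apply gN_sub_swap. replace m with (N + (m - N))%nat by lia. apply G.
Qed.

(* Baire's theorem: were the conclusion false, nested balls B(w_k, 2 r_k) would shrink to a
   point of W missed by every A_k. *)
Lemma baire (W : V -> Prop) (A : nat -> V -> Prop) :
  (exists w, W w) -> (forall w, W w -> gdom w) -> gclosed W ->
  (forall w, W w -> exists n, A n w) ->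
  exists n w0 r, W w0 /\ 0 < r /\ forall w, W w -> gN (vsub w w0) r ->
    forall eps, 0 < eps -> exists a, A n a /\ gN (vsub w a) eps.
Proof.
  intros [w00 Hw00] HWd HWc Hcov. apply NNPP. intros Hno.
  assert (Hstep : forall (n : nat) (p : {p : V * R | W (fst p) /\ 0 < snd p}),
    exists q : {q : V * R | W (fst q) /\ 0 < snd q},
      snd (proj1_sig q) <= snd (proj1_sig p) / 4 /\
      gN (vsub (fst (proj1_sig q)) (fst (proj1_sig p))) (snd (proj1_sig p) / 2) /\
      forall a, A n a -> ~ gN (vsub (fst (proj1_sig q)) a) (2 * snd (proj1_sig q))).
  { intros n [[w0 r] [Hw0 Hr]]; simpl in *. apply NNPP. intros Hq. apply Hno.
    exists n, w0, (r/2). split; [exact Hw0|]. split; [lra|].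
    intros w Hw Hww eps He. apply NNPP. intros Ha. apply Hq.
    assert (Hm : 0 < Rmin (r/4) (eps/2)) by (apply Rmin_glb_lt; lra).
    (* The bound [r/4] nests the balls and shrinks them geometrically; [eps/2] makes the ball of
       doubled radius about [w] miss [A n]. *)
    exists (exist _ (w, Rmin (r/4) (eps/2)) (conj Hw Hm)); simpl.
    split; [apply Rmin_l|]. split; [exact Hww|].
    intros a Haa HN. apply Ha. exists a. split; [exact Haa|].
    eapply gN_mon; [exact HN|]. pose proof (Rmin_r (r/4) (eps/2)). lra. }
  set (next n p := proj1_sig (constructive_indefinite_description _ (Hstep n p))).
  assert (Hnext : forall n p, _) by
    exact (fun n p => proj2_sig (constructive_indefinite_description _ (Hstep n p))).
  set (s := fix s n := match n with O => exist _ (w00, 1) (conj Hw00 Rlt_0_1)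
                       | S k => next k (s k) end).
  set (w n := fst (proj1_sig (s n))). set (r n := snd (proj1_sig (s n))).
  assert (Hr : forall n, 0 < r n) by (intros n; apply (proj2_sig (s n))).
  assert (HW : forall n, W (w n)) by (intros n; apply (proj2_sig (s n))).
  assert (Hr4 : forall n, r (S n) <= r n / 4) by (intros n; apply (Hnext n (s n))).
  assert (Hwr : forall n, gN (vsub (w (S n)) (w n)) (r n / 2))
    by (intros n; apply (Hnext n (s n))).
  assert (HA : forall n a, A n a -> ~ gN (vsub (w (S n)) a) (2 * r (S n)))
    by (intros n; apply (Hnext n (s n))).
  assert (Hball : forall n p x, gN (vsub x (w (n + p)%nat)) (2 * r (n + p)%nat) ->
                           gN (vsub x (w n)) (2 * r n)).
  { intros n p. induction p as [|p IH]; intros x Hx.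
    - now rewrite Nat.add_0_r in Hx.
    - apply IH. rewrite Nat.add_succ_r in Hx.
      eapply gN_mon; [eapply gN_sub_trans; [exact Hx|apply Hwr]|].
      specialize (Hr4 (n + p)%nat). specialize (Hr (n + p)%nat). lra. }
  assert (Hpow : forall n, r n <= (/2)^n).
  { intros n. induction n as [|n IH]; [unfold r; simpl; lra|].
    specialize (Hr4 n). specialize (Hr n). simpl. lra. }
  destruct (geometric_cv w 1) as (l & Hld & Hl).
  { now apply HWd. }
  { intros n. eapply gN_mon; [apply Hwr|]. specialize (Hpow n). specialize (Hr n). lra. }
  assert (HWl : W l) by (apply (HWc w l); auto).
  destruct (Hcov l HWl) as [n Hn].
  (* The limit is within [r (n+2)] of a late centre, that centre within [2 r (n+2)] of [w (n+2)],
     and the latter within [r (n+1) / 2] of [w (n+1)]. The total stays below [2 r (n+1)], the radius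
     of the ball that misses [A n]. *)
  destruct (Hl (r (S (S n)))) as [N HN]; [apply Hr|].
  apply (HA n l Hn). apply gN_sub_swap.
  specialize (HN (N + S (S n))%nat ltac:(lia)). apply gN_sub_swap in HN.
  assert (Hc : gN (vsub (w (S (S n) + N)%nat) (w (S (S n)))) (2 * r (S (S n)))).
  { apply (Hball _ N). apply (gN_eq vzero); [|vmod_ring].
    apply gN_zero. specialize (Hr (S (S n) + N)%nat). lra. }
  rewrite Nat.add_comm in HN.
  eapply gN_mon; [eapply gN_sub_trans; [exact HN|eapply gN_sub_trans; [exact Hc|apply Hwr]]|].
  pose proof (Hr4 (S n)). pose proof (Hr (S n)). pose proof (Hr (S (S n))). lra.
Qed.

End GaugeBasics.

(** * Interior of the image of a convex set *)

Section OpenMapping.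
Context {B V : Gauged} (L : B -> V).
Context (Ladd : forall x y, L (vadd x y) = vadd (L x) (L y)).
Context (Lscal : forall a x, L (vscal a x) = vscal a (L x)).
Context (Lbd : exists M, 0 < M /\ forall b r, gN b r -> gN (L b) (M * r)).

Lemma convex_set_le (C : B -> Prop) x y t :
  convex_set C -> C x -> C y -> 0 <= t <= 1 -> C (vadd (vscal t x) (vscal (1 - t) y)).
Proof.
  intros HC Hx Hy Ht. destruct (Req_dec t 0) as [->|H0].
  - apply (subspace_eq _ y); [exact Hy|vmod_ring].
  - destruct (Req_dec t 1) as [->|H1].
    + apply (subspace_eq _ x); [exact Hx|vmod_ring].
    + apply HC; auto. lra.
Qed.

Lemma L_gdom b : gdom b -> gdom (L b).
Proof. destruct Lbd as (M & _ & H). intros [r Hr]. exists (M * r). now apply H. Qed.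

Lemma L_gcv c b : gcv c b -> gcv (fun n => L (c n)) (L b).
Proof.
  destruct Lbd as (M & HM & H). intros Hc eps He.
  destruct (Hc (eps / M)) as [N HN]; [now apply Rdiv_lt_0_compat|].
  exists N. intros n Hn. specialize (H _ _ (HN n Hn)).
  replace (M * (eps / M)) with eps in H by (field; lra).
  apply (gN_eq _ _ _ H). unfold vsub. now rewrite Ladd, Lscal.
Qed.

(* The open mapping iteration: correcting the error with weights 2^-k gives convex
   combinations of points of K whose limit, in C, is mapped exactly onto the target. *)
Lemma exact_of_dense (W : V -> Prop) (C K : B -> Prop) u r Q :
  subspace W -> (forall w, W w -> gdom w) -> convex_set C -> gclosed C ->
  (forall b, K b -> C b /\ gN b Q /\ W (vsub (L b) u)) -> gdom u -> 0 < r ->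
  (forall v, W v -> gN v r -> forall eps, 0 < eps ->
     exists b, K b /\ gN (vsub (vadd u v) (L b)) eps) ->
  forall w, W w -> gN w (r / 2) -> exists b, C b /\ L b = vadd u w.
Proof.
  intros HW HWd HC HCc HK Hu Hr Hd w Hw Hwr.
  destruct (Hd vzero (proj1 HW) (gN_zero V r Hr) 1 Rlt_0_1) as (b0 & Hb0 & _).
  (* Density is used at [2 e], still of gauge below [r]; the new error [u + 2 e - L b] again has
     gauge below [r / 2], so the step repeats. *)
  assert (Hstep : forall e : V, exists p : B * V, W e /\ gN e (r / 2) ->
    K (fst p) /\ snd p = vsub (vadd u (vscal 2 e)) (L (fst p)) /\
    W (snd p) /\ gN (snd p) (r / 2)).
  { intros e. destruct (classic (W e /\ gN e (r / 2))) as [[He Hn]|Hn].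
    - destruct (Hd (vscal 2 e)) with (eps := r / 2) as (b & Hb & Hbe).
      + now apply HW.
      + eapply gN_scal_le; [exact Hn| |lra]. rewrite Rabs_pos_eq; lra.
      + lra.
      + exists (b, vsub (vadd u (vscal 2 e)) (L b)). intros _. simpl.
        repeat split; auto.
        apply (subspace_eq _ (vsub (vscal 2 e) (vsub (L b) u))); [|vmod_ring].
        apply subspace_sub; auto; [now apply HW|now apply HK].
    - exists (b0, e). tauto. }
  set (f e := proj1_sig (constructive_indefinite_description _ (Hstep e))).
  assert (Hf : forall e, _) by
    exact (fun e => proj2_sig (constructive_indefinite_description _ (Hstep e))).
  set (e := fix e n := match n with O => w | S k => snd (f (e k)) end).
  set (b := fun n => fst (f (e n))).
  assert (He : forall n, W (e n) /\ gN (e n) (r / 2)).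
  { induction n as [|n IH]; [auto|]. simpl. split; now apply (Hf (e n)). }
  assert (Hb : forall n, K (b n)) by (intros n; apply (Hf (e n)), He).
  assert (Hes : forall n, e (S n) = vsub (vadd u (vscal 2 (e n))) (L (b n)))
    by (intros n; apply (Hf (e n)), He).
  (* The weights used up to stage [n] sum to [1 - 2^-n]; [Hs] says that giving the remaining [2^-n]
     to any point of [C] stays in [C]. *)
  set (s := fix s n : B := match n with O => vzero | S k => vadd (s k) (vscal ((/2)^(S k)) (b k)) end).
  assert (Hs : forall n q, C q -> C (vadd (s n) (vscal ((/2)^n) q))).
  { induction n as [|n IH]; intros q Hq.
    - apply (subspace_eq _ q); [exact Hq|]. simpl. vmod_ring.
    - apply (subspace_eq _ (vadd (s n) (vscal ((/2)^n)
        (vadd (vscal (/2) (b n)) (vscal (1 - /2) q))))).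
      + apply IH. apply HC; [apply HK, Hb|exact Hq|lra].
      + simpl. vmod; field. }
  assert (Hp : forall n, 0 < (/2)^n) by (intros n; apply pow_lt; lra).
  assert (HLs : forall n, L (s n) =
    vsub (vadd (vscal (1 - (/2)^n) u) w) (vscal ((/2)^n) (e n))).
  { induction n as [|n IH].
    - simpl. replace (L vzero) with (vscal 0 (L vzero)).
      + vmod_ring.
      + rewrite <- Lscal. f_equal. vmod_ring.
    - rewrite Hes. simpl s. rewrite Ladd, Lscal, IH. simpl. vmod; field. }
  (* The remaining weight goes to the fixed point [b0], so that consecutive terms differ by
     [2^-(n+1) (b n - b0)], of gauge below [Q 2^-n]. *)
  set (c := fun n => vadd (s n) (vscal ((/2)^n) b0)).
  destruct (HK b0 Hb0) as (Cb0 & Nb0 & Wb0).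
  destruct (geometric_cv c Q) as (l & Hld & Hl).
  - exists Q. apply (gN_eq b0); [exact Nb0|]. unfold c; simpl. vmod_ring.
  - intros n. apply (gN_eq (vscal ((/2)^(S n)) (vsub (b n) b0))).
    + eapply gN_scal_le.
      * apply gN_sub; [apply HK, Hb|exact Nb0].
      * rewrite Rabs_pos_eq; [|apply Rlt_le, Hp]. simpl. lra.
      * apply Rmult_lt_0_compat; [exact (gN_pos _ _ _ Nb0)|apply Hp].
    + unfold c; simpl. vmod; field.
  - exists l. split; [apply (HCc c l); auto|].
    + intros n. now apply Hs.
    + apply (gcv_unique (fun n => L (c n))); [now apply L_gcv|].
      intros eps Heps. destruct (HWd _ Wb0) as [q Hq].
      destruct (pow_half_small (q + r / 2) eps Heps) as [N HN].
      exists N. intros n Hn.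
      apply (gN_eq (vscal ((/2)^n) (vsub (vsub (L b0) u) (e n)))).
      * eapply gN_scal_le; [apply gN_sub; [exact Hq|apply He]| |exact Heps].
        rewrite Rabs_pos_eq; [|apply Rlt_le, Hp]. specialize (HN n Hn). lra.
      * unfold c. rewrite Ladd, Lscal, HLs. vmod_ring.
Qed.

Context (C : nat -> B -> Prop).
Context (Cconvex : forall n, convex_set (C n)) (Cclosed : forall n, gclosed (C n)).
Context (Cmono : forall n m b, C n b -> (n <= m)%nat -> C m b).
Context (Cdom : forall n b, C n b -> gdom b).

Definition image : V -> Prop := fun z => exists n b, C n b /\ z = L b.

(** The strict bound makes the iteration converge but need not be a closed condition. This is why
    [exact_of_dense] separates [K], which supplies the points, from the closed [C], which receives
    the limit. *)
Definition bounded_part (n : nat) (b : B) : Prop := C n b /\ gN b (INR n).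

Lemma bounded_part_convex n : convex_set (bounded_part n).
Proof.
  intros x y t [Hx Nx] [Hy Ny] Ht. split; [now apply Cconvex|].
  pose proof (gN_pos _ _ _ Nx).
  replace (INR n) with (t * INR n + (1 - t) * INR n) by ring.
  apply gN_add; (eapply gN_scal_le; [eassumption| |nra]); rewrite Rabs_pos_eq; lra.
Qed.

Lemma bounded_part_mono n m b : bounded_part n b -> (n <= m)%nat -> bounded_part m b.
Proof.
  intros [H1 H2] Hnm. split; [eauto|]. eapply gN_mon; [exact H2|now apply le_INR].
Qed.

Lemma image_bounded z : image z -> exists n b, bounded_part n b /\ z = L b.
Proof.
  intros (n & b & Hb & ->). destruct (Cdom n b Hb) as [r Hr].
  destruct (INR_unbounded r) as [m Hm].
  exists (n + m)%nat, b. split; [split|reflexivity].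
  - apply (Cmono n); [exact Hb|lia].
  - eapply gN_mon; [exact Hr|]. rewrite plus_INR. pose proof (pos_INR n). lra.
Qed.

(** [icr] does not state membership; it follows from the direction 0, which is available once the
    image is nonempty. *)
Lemma icr_image_mem u : (exists z, image z) -> icr image u -> image u.
Proof.
  intros [z Hz] Hu. destruct (Hu vzero) as (d & Hd & H).
  - apply (aff_setsub (gL V) image z); [exact Hz|].
    now apply directions_subspace; [apply gL|apply aff_incl; [apply gL|]].
  - apply (subspace_eq _ _ u (H 0 ltac:(lra))). vmod_ring.
Qed.

(** Baire's theorem is applied in the direction space [W], complete as a closed subspace, to the
    sets of [w] for which [u + w / (n+1)] is the image of a point of the bounded part [n]. *)
Lemma icr_image_interior u : (exists z, image z) -> gclosed (aff image) -> icr image u ->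
  exists r, 0 < r /\ forall w, aff image w -> gN (vsub w u) r -> image w.
Proof.
  intros Hne Hcl Hicr. pose proof (icr_image_mem u Hne Hicr) as Hu.
  set (W := directions image u).
  assert (HW : subspace W) by (apply directions_subspace; [apply gL|now apply aff_incl; [apply gL|]]).
  assert (Hicr' : forall w, W w -> exists delta, 0 < delta /\
    forall lam, 0 <= lam <= delta -> image (vadd u (vscal lam w))).
  { intros w Hw. apply Hicr. now apply (aff_setsub (gL V) image u). }
  assert (HE : forall z, image z -> gdom z).
  { intros z (n & b & Hb & ->). apply L_gdom. eauto. }
  assert (Hud : gdom u) by now apply HE.
  assert (HWd : forall w, W w -> gdom w).
  { intros w Hw. apply (subspace_eq _ (vsub (vsub (vadd u w) vzero) u)); [|vmod_ring].
    apply subspace_sub; [apply gdom_subspace| |exact Hud].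
    apply (aff_sub_mem (gL V) _ image); [apply gdom_subspace| |exact Hw].
    intros x Hx. apply subspace_sub; [apply gdom_subspace|now apply HE|apply gdom_subspace]. }
  assert (HWc : gclosed W).
  { intros s w Hs Hw Hcv. apply (Hcl (fun n => vadd u (s n))); [exact Hs|now apply gdom_subspace|].
    intros eps He. destruct (Hcv eps He) as [N HN]. exists N. intros n Hn.
    apply (gN_eq _ _ _ (HN n Hn)). vmod_ring. }
  assert (HS : forall n, 0 < INR (S n)) by (intros n; apply lt_0_INR; lia).
  destruct (image_bounded u Hu) as (k0 & b0 & Hb0 & Eu).
  destruct (baire W (fun n w => exists b, bounded_part n b /\
      vadd u (vscal (/ INR (S n)) w) = L b)) as (n & w0 & r & Hw0 & Hr & Hball).
  - exists vzero. apply HW.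
  - exact HWd.
  - exact HWc.
  - intros w Hw. destruct (Hicr' w Hw) as (d & Hd & Hlam).
    destruct (archimed_cor1 d Hd) as (m & Hm & Hm0).
    destruct (image_bounded (vadd u (vscal (/ INR m) w))) as (k & b & Hb & Eb).
    { apply Hlam. split; [|lra]. apply Rlt_le, Rinv_0_lt_compat, lt_0_INR, Hm0. }
    (* A single index must serve as both scale and bound. Mixing [u + w / m] with [u = L b0] at
       weight [t] gives [u + w / (n+1)], and [n >= m] ensures [t <= 1]. *)
    set (n := (m + k + k0)%nat). set (t := INR m / INR (S n)).
    assert (Hmp : 0 < INR m) by (apply lt_0_INR, Hm0).
    assert (Hmn : INR m <= INR (S n)) by (apply le_INR; lia).
    exists n, (vadd (vscal t b) (vscal (1 - t) b0)). split.
    + apply convex_set_le.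
      * apply bounded_part_convex.
      * apply (bounded_part_mono k); [exact Hb|lia].
      * apply (bounded_part_mono k0); [exact Hb0|lia].
      * specialize (HS n). unfold t. split.
        -- apply Rlt_le, Rdiv_lt_0_compat; lra.
        -- apply (Rmult_le_reg_r (INR (S n))); [lra|].
           unfold Rdiv. rewrite Rmult_assoc, Rinv_l; lra.
    + rewrite Ladd, !Lscal, <- Eb, <- Eu. specialize (HS n).
      unfold t. vmod; field; lra.
  - destruct (Hicr' (vscal (-1) (vscal (/ INR (S n)) w0))) as (d & Hd & Hlam).
    { now apply HW, HW. }
    destruct (image_bounded _ (Hlam d ltac:(lra))) as (m & b' & Hb' & Eb').
    (* Solution of [t = (1 - t) d]: mixing with [b'], the preimage of [u - d w0 / (n+1)], cancels
       [w0] and moves the ball's centre to [u]. *)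
    set (t := d / (1 + d)).
    assert (Ht : 0 < t < 1).
    { unfold t. split; [apply Rdiv_lt_0_compat; lra|].
      apply (Rmult_lt_reg_r (1 + d)); [lra|].
      unfold Rdiv. rewrite Rmult_assoc, Rinv_l; lra. }
    pose proof (HS n) as Hn.
    assert (Htn : 0 < t * / INR (S n)).
    { apply Rmult_lt_0_compat; [lra|now apply Rinv_0_lt_compat]. }
    set (r2 := t * / INR (S n) * r).
    assert (Hr2 : 0 < r2) by (now apply Rmult_lt_0_compat).
    exists (r2 / 2). split; [lra|]. intros z Hz HzN.
    destruct (exact_of_dense W (C (n + m)%nat) (bounded_part (n + m)) u r2 (INR (n + m)))
      with (w := vsub z u) as (b & Hb & Eb); auto.
    + intros b [Hb1 Hb2]. split; [auto|split; [auto|]].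
      apply aff_directions; [apply gL|]. apply aff_incl; [apply gL|].
      exists (n + m)%nat, b. auto.
    + intros v Hv HvN eps Heps.
      set (x := vadd w0 (vscal (/ (t * / INR (S n))) v)).
      destruct (Hball x) with (eps := eps / (t * / INR (S n))) as (a & (b & Hb & Eb) & Ha).
      * apply HW; [exact Hw0|now apply HW].
      * apply (gN_eq (vscal (/ (t * / INR (S n))) v)); [|unfold x; vmod_ring].
        eapply gN_scal_le; [exact HvN| |exact Hr].
        rewrite Rabs_pos_eq by (apply Rlt_le, Rinv_0_lt_compat, Htn).
        unfold r2. right. field. lra.
      * now apply Rdiv_lt_0_compat.
      * exists (vadd (vscal t b) (vscal (1 - t) b')). split.
        -- apply bounded_part_convex; [..|exact Ht].
           ++ apply (bounded_part_mono n); [exact Hb|lia].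
           ++ apply (bounded_part_mono m); [exact Hb'|lia].
        -- apply (gN_eq (vscal (t * / INR (S n)) (vsub x a))).
           ++ eapply gN_scal_le; [exact Ha| |exact Heps].
              rewrite Rabs_pos_eq by lra. right. field. lra.
           ++ rewrite Ladd, !Lscal, <- Eb, <- Eb'.
              unfold x, t. vmod; field; lra.
    + now apply aff_directions; [apply gL|].
    + exists (n + m)%nat, b. split; [exact Hb|]. rewrite Eb. vmod_ring.
Qed.

End OpenMapping.

(** * Hahn-Banach separation from a closed subspace *)

Section HahnBanach.
Context {V : Gauged} (W : V -> Prop) (z0 : V).
Context (HW : subspace W) (HWc : gclosed W) (Hz0 : gdom z0) (Hz0W : ~ W z0).

(** The distance to [W], that is the quotient seminorm, is smaller than [r]. A functional dominated
    by it is continuous and vanishes on [W] at the same time. *)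
Definition near_subspace (z : V) (r : R) : Prop := exists w, W w /\ gN (vsub z w) r.

Lemma near_add x y r s :
  near_subspace x r -> near_subspace y s -> near_subspace (vadd x y) (r + s).
Proof.
  intros (v & Hv & Nv) (w & Hw & Nw). exists (vadd v w). split; [now apply HW|].
  apply (gN_eq (vadd (vsub x v) (vsub y w))); [now apply gN_add|vmod_ring].
Qed.

Lemma near_scal t x r : t <> 0 ->
  near_subspace x r -> near_subspace (vscal t x) (Rabs t * r).
Proof.
  intros Ht (v & Hv & Nv). exists (vscal t v). split; [now apply HW|].
  apply (gN_eq (vscal t (vsub x v))); [now apply gN_scal|vmod_ring].
Qed.

Lemma near_dom x r : gN x r -> near_subspace x r.
Proof.
  intros H. exists vzero. split; [apply HW|]. apply (gN_eq _ _ _ H). vmod_ring.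
Qed.

Lemma near_mem w r : W w -> 0 < r -> near_subspace w r.
Proof.
  intros Hw Hr. exists w. split; [exact Hw|].
  apply (gN_eq vzero); [now apply gN_zero|vmod_ring].
Qed.

Lemma near_pos x r : near_subspace x r -> 0 < r.
Proof. intros (w & _ & H). exact (gN_pos _ _ _ H). Qed.

Lemma positive_distance : exists d, 0 < d /\ forall r, near_subspace z0 r -> d <= r.
Proof.
  apply NNPP. intros Hno. apply Hz0W.
  assert (H : forall n, near_subspace z0 ((/2)^n)).
  { intros n. apply NNPP. intros Hn. apply Hno. exists ((/2)^n).
    split; [apply pow_lt; lra|]. intros r (w & Hw & Nw).
    apply Rnot_lt_le. intros Hr. apply Hn. exists w. split; [exact Hw|].
    eapply gN_mon; [exact Nw|lra]. }
  set (u n := proj1_sig (constructive_indefinite_description _ (H n))).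
  assert (Hu : forall n, W (u n) /\ gN (vsub z0 (u n)) ((/2)^n)) by
    (intros n; apply (proj2_sig (constructive_indefinite_description _ (H n)))).
  apply (HWc u); [apply Hu|exact Hz0|].
  intros eps He. destruct (pow_half_small 1 eps He) as [N HN].
  exists N. intros n Hn. specialize (HN n Hn). apply gN_sub_swap.
  eapply gN_mon; [apply Hu|lra].
Qed.

(* Partial functionals are handled as linear subspaces of V x R; being dominated makes them
   functional graphs. *)
Definition dominated_graph (d : R) (G : V * R -> Prop) : Prop :=
  G (z0, d) /\
  (forall x s y t, G (x, s) -> G (y, t) -> G (vadd x y, s + t)) /\
  (forall a x s, G (x, s) -> G (vscal a x, a * s)) /\
  (forall x s r, G (x, s) -> near_subspace x r -> s <= r).

Lemma line_dominated d : 0 < d -> (forall r, near_subspace z0 r -> d <= r) ->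
  dominated_graph d (fun p => exists t, p = (vscal t z0, t * d)).
Proof.
  intros Hd Hdist. split; [|split; [|split]].
  - exists 1. f_equal; [vmod_ring|ring].
  - intros x s y t [a Ea] [b Eb]. injection Ea as -> ->. injection Eb as -> ->.
    exists (a + b). f_equal; [vmod_ring|ring].
  - intros a x s [b Eb]. injection Eb as -> ->. exists (a * b). f_equal; [vmod_ring|ring].
  - intros x s r [t Et] Hr. injection Et as -> ->.
    pose proof (near_pos _ _ Hr) as Hr0.
    destruct (Rle_lt_dec t 0) as [Ht|Ht]; [nra|].
    assert (Hn : near_subspace z0 (/ t * r)).
    { apply (near_scal (/ t)) in Hr; [|apply Rinv_neq_0_compat; lra].
      rewrite Rabs_pos_eq in Hr by (apply Rlt_le, Rinv_0_lt_compat, Ht).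
      replace z0 with (vscal (/ t) (vscal t z0)); [exact Hr|]. vmod; field; lra. }
    apply Hdist in Hn. apply (Rmult_le_compat_l t) in Hn; [|lra].
    rewrite <- Rmult_assoc, Rinv_r in Hn; lra.
Qed.

(** The lower bounds [s - r] on the value at [v] lie below all upper bounds [r' - s'], since adding
    the two vectors cancels [v]; the value [a] is the supremum of the lower bounds. *)
Lemma extension_value d G v : dominated_graph d G -> gdom v ->
  exists a, (forall x s r, G (x, s) -> near_subspace (vsub x v) r -> s - a <= r) /\
            (forall x s r, G (x, s) -> near_subspace (vadd x v) r -> s + a <= r).
Proof.
  intros (G0 & Gadd & Gscal & Gdom) [q Hq].
  assert (Gzero : G (vzero, 0)).
  { generalize (Gscal 0 _ _ G0). rewrite (vl_scal0 _ (gL V)), Rmult_0_l. auto. }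
  set (E := fun b => exists x s r, G (x, s) /\ near_subspace (vsub x v) r /\ b = s - r).
  assert (Hup : forall x s r, G (x, s) -> near_subspace (vadd x v) r -> is_upper_bound E (r - s)).
  { intros x s r Hx Hr b (x' & s' & r' & Hx' & Hr' & ->).
    enough (s' + s <= r' + r) by lra.
    apply (Gdom (vadd x' x)); [now apply Gadd|].
    replace (vadd x' x) with (vadd (vsub x' v) (vadd x v)); [now apply near_add|vmod_ring]. }
  destruct (completeness E) as [a [Ha1 Ha2]].
  - exists (q - 0). apply (Hup vzero); [exact Gzero|]. apply near_dom.
    apply (gN_eq _ _ _ Hq). vmod_ring.
  - exists (0 - q), vzero, 0, q. split; [exact Gzero|split; [|reflexivity]].
    apply near_dom. apply gN_sub_swap. apply (gN_eq _ _ _ Hq). vmod_ring.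
  - exists a. split.
    + intros x s r Hx Hr. enough (s - r <= a) by lra. apply Ha1. exists x, s, r. auto.
    + intros x s r Hx Hr. specialize (Ha2 _ (Hup _ _ _ Hx Hr)). lra.
Qed.

Lemma graph_extension d G v a : dominated_graph d G ->
  (forall x s r, G (x, s) -> near_subspace (vsub x v) r -> s - a <= r) ->
  (forall x s r, G (x, s) -> near_subspace (vadd x v) r -> s + a <= r) ->
  dominated_graph d (fun p => exists x s t, G (x, s) /\ p = (vadd x (vscal t v), s + t * a)).
Proof.
  intros (G0 & Gadd & Gscal & Gdom) Hminus Hplus. split; [|split; [|split]].
  - exists z0, d, 0. split; [exact G0|]. f_equal; [vmod_ring|ring].
  - intros x s y t (x1 & s1 & t1 & H1 & E1) (x2 & s2 & t2 & H2 & E2).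
    injection E1 as -> ->. injection E2 as -> ->.
    exists (vadd x1 x2), (s1 + s2), (t1 + t2). split; [now apply Gadd|].
    f_equal; [vmod_ring|ring].
  - intros b x s (x1 & s1 & t1 & H1 & E1). injection E1 as -> ->.
    exists (vscal b x1), (b * s1), (b * t1). split; [now apply Gscal|].
    f_equal; [vmod_ring|ring].
  - intros x s r (x1 & s1 & t & H1 & E1) Hr. injection E1 as -> ->.
    destruct (Req_dec t 0) as [->|Ht].
    + rewrite Rmult_0_l, Rplus_0_r. apply (Gdom x1); [exact H1|].
      replace x1 with (vadd x1 (vscal 0 v)); [exact Hr|vmod_ring].
    (* Scaling by [/ Rabs t] turns the coefficient of [v] into 1 or -1, the cases of [Hplus] and
       [Hminus]. *)
    + assert (Hi : 0 < / Rabs t) by (apply Rinv_0_lt_compat, Rabs_pos_lt, Ht).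
      apply (near_scal (/ Rabs t)) in Hr; [|lra].
      rewrite (Rabs_pos_eq (/ Rabs t)) in Hr by lra.
      enough (/ Rabs t * (s1 + t * a) <= / Rabs t * r) by (apply Rmult_le_reg_l in H; auto).
      destruct (Rlt_le_dec t 0) as [Hn|Hp].
      * rewrite Rabs_left in * by lra.
        replace (/ - t * (s1 + t * a)) with (/ - t * s1 - a) by (field; lra).
        apply (Hminus (vscal (/ - t) x1)); [now apply Gscal|].
        replace (vsub (vscal (/ - t) x1) v) with (vscal (/ - t) (vadd x1 (vscal t v)));
          [exact Hr|vmod; field; lra].
      * rewrite Rabs_pos_eq in * by lra.
        replace (/ t * (s1 + t * a)) with (/ t * s1 + a) by (field; lra).
        apply (Hplus (vscal (/ t) x1)); [now apply Gscal|].
        replace (vadd (vscal (/ t) x1) v) with (vscal (/ t) (vadd x1 (vscal t v)));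
          [exact Hr|vmod; field; lra].
Qed.

Lemma maximal_graph d : 0 < d -> (forall r, near_subspace z0 r -> d <= r) ->
  exists G, dominated_graph d G /\ forall v, gdom v -> exists s, G (v, s).
Proof.
  intros Hd Hdist.
  (* Zorn's lemma also asks for the union of the empty chain, hence the guard [exists p, G p]. The
     maximal set is nonempty all the same, because the line through [z0] strictly contains the empty
     set. *)
  destruct (@classical_sets.Zorn_bigcup (V * R)%type
    (fun G => (exists p, G p) -> dominated_graph d G)) as (G & HG & Gmax).
  - intros F HF Ftot [p [G0 FG0 HG0]].
    assert (Hcommon : forall p q, classical_sets.bigcup F (fun X => X) p ->
       classical_sets.bigcup F (fun X => X) q -> exists G, F G /\ dominated_graph d G /\ G p /\ G q).
    { intros p1 p2 [G1 F1 H1] [G2 F2 H2]. destruct (Ftot G1 G2 F1 F2) as [H|H].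
      - exists G2. split; [exact F2|]. split; [apply (HF G2 F2); eauto|]. auto.
      - exists G1. split; [exact F1|]. split; [apply (HF G1 F1); eauto|]. auto. }
    split; [|split; [|split]].
    + exists G0; [exact FG0|]. apply (HF G0 FG0). eauto.
    + intros x s y t Hx Hy. destruct (Hcommon _ _ Hx Hy) as (G & FG & DG & Gx & Gy).
      exists G; [exact FG|]. destruct DG as (_ & DGa & DGs & _); auto.
    + intros a x s Hx. destruct (Hcommon _ _ Hx Hx) as (G & FG & DG & Gx & _).
      exists G; [exact FG|]. destruct DG as (_ & DGa & DGs & _); auto.
    + intros x s r Hx. destruct (Hcommon _ _ Hx Hx) as (G & FG & DG & Gx & _).
      now apply DG.
  - assert (Gne : exists p, G p).
    { apply NNPP. intros Hn.
      apply (Gmax (fun p => exists t, p = (vscal t z0, t * d))).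
      - split.
        + intros p Hp. contradiction Hn; eauto.
        + intros H. apply Hn. exists (vscal 1 z0, 1 * d). apply H. eauto.
      - intros _. now apply line_dominated. }
    specialize (HG Gne). exists G. split; [exact HG|].
    intros v Hv. apply NNPP. intros Hn.
    destruct (extension_value d G v HG Hv) as (a & Hminus & Hplus).
    apply (Gmax (fun p => exists x s t, G (x, s) /\ p = (vadd x (vscal t v), s + t * a))).
    + split.
      * intros [x s] Hp. exists x, s, 0. split; [exact Hp|]. f_equal; [vmod_ring|ring].
      * intros H. apply Hn. exists (0 * d + 1 * a). apply H.
        exists (vscal 0 z0), (0 * d), 1. split; [|f_equal; vmod_ring].
        destruct HG as (HG0 & _ & HGs & _); auto.
    + intros _. now apply graph_extension.
Qed.

Theorem hahn_banach_separation : exists F : V -> R,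
  (forall x y, gdom x -> gdom y -> F (vadd x y) = F x + F y) /\
  (forall a x, gdom x -> F (vscal a x) = a * F x) /\
  (forall x r, gN x r -> Rabs (F x) <= r) /\
  (forall w, W w -> gdom w -> F w = 0) /\ F z0 <> 0.
Proof.
  destruct positive_distance as (d & Hd & Hdist).
  destruct (maximal_graph d Hd Hdist) as (G & (G0 & Gadd & Gscal & Gdom) & Gtot).
  (* The difference [s - t] lies over the zero vector, whose distance to [W] is below every positive
     radius. *)
  assert (Guniq : forall x s t, G (x, s) -> G (x, t) -> s <= t).
  { intros x s t Hs Ht. apply Rnot_lt_le. intros Hlt.
    pose proof (Gadd _ _ _ _ Hs (Gscal (-1) _ _ Ht)) as H.
    enough (s + -1 * t <= (s - t) / 2) by lra.
    apply (Gdom _ _ _ H). apply near_dom, (gN_eq vzero); [apply gN_zero; lra|vmod_ring]. }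
  assert (Hch : forall x : V, exists s, gdom x -> G (x, s)).
  { intros x. destruct (classic (gdom x)) as [Hx|Hx].
    - destruct (Gtot x Hx) as [s Hs]. eauto.
    - exists 0. tauto. }
  set (F x := proj1_sig (constructive_indefinite_description _ (Hch x))).
  assert (HF : forall x, gdom x -> G (x, F x)) by
    (intros x; apply (proj2_sig (constructive_indefinite_description _ (Hch x)))).
  clearbody F.
  assert (Fle : forall x r, gdom x -> near_subspace x r -> Rabs (F x) <= r).
  { intros x r Hx Hr. apply Rabs_le. split.
    - enough (-1 * F x <= r) by lra. apply (Gdom (vscal (-1) x)); [now apply Gscal, HF|].
      apply (near_scal (-1)) in Hr; [|lra].
      rewrite Rabs_left in Hr by lra. now replace (- -1 * r) with r in Hr by ring.
    - apply (Gdom x); [now apply HF|exact Hr]. }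
  exists F. repeat split.
  - intros x y Hx Hy. assert (Hxy : gdom (vadd x y)) by now apply gdom_subspace.
    apply Rle_antisym; eapply Guniq; eauto.
  - intros a x Hx. assert (Hax : gdom (vscal a x)) by now apply gdom_subspace.
    apply Rle_antisym; eapply Guniq; eauto.
  - intros x r Hx. apply Fle; [now exists r|now apply near_dom].
  - intros w Hw Hwd. apply NNPP. intros Hn. apply Rabs_pos_lt in Hn.
    assert (Rabs (F w) <= Rabs (F w) / 2) by (apply Fle; [exact Hwd|apply near_mem; auto; lra]).
    lra.
  - enough (d <= F z0) by lra. eapply Guniq; eauto.
Qed.

End HahnBanach.

(** * Banach spaces, their duals and products *)

Section NormedSpaces.
Context {X : NormedSpace}.
Implicit Types x y : X.

Lemma ns_cancel_idem x : ns_add x x = x -> x = ns_zero.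
Proof.
  intros H. rewrite <- (ns_add_0 _ x), <- (ns_add_opp _ x), ns_add_assoc, H.
  now rewrite ns_add_opp.
Qed.

Lemma ns_scal_0 x : ns_scal 0 x = ns_zero.
Proof.
  apply ns_cancel_idem. rewrite <- ns_scal_distr_r. f_equal; ring.
Qed.

Lemma ns_opp_scal x : ns_opp x = ns_scal (-1) x.
Proof.
  assert (H : ns_add x (ns_scal (-1) x) = ns_zero).
  { rewrite <- (ns_scal_1 _ x) at 1. rewrite <- ns_scal_distr_r.
    replace (1 + -1) with 0 by ring. apply ns_scal_0. }
  rewrite <- (ns_add_0 _ (ns_opp x)), <- H, ns_add_assoc, (ns_add_comm _ (ns_opp x)).
  rewrite ns_add_opp, ns_add_comm. apply ns_add_0.
Qed.

Lemma ns_norm_zero : ns_norm (@ns_zero X) = 0.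
Proof. rewrite <- (ns_scal_0 ns_zero), ns_norm_scal, Rabs_R0. ring. Qed.

Lemma ns_norm_nonneg x : 0 <= ns_norm x.
Proof.
  pose proof (ns_norm_triangle _ x (ns_opp x)) as H.
  rewrite ns_add_opp, ns_norm_zero, ns_opp_scal, ns_norm_scal in H.
  rewrite Rabs_left in H; lra.
Qed.

Lemma nsV_laws : VLaws (nsV X).
Proof.
  constructor; simpl.
  - apply ns_add_assoc.
  - apply ns_add_comm.
  - apply ns_add_0.
  - apply ns_scal_0.
  - apply ns_scal_assoc.
  - apply ns_scal_1.
  - apply ns_scal_distr_l.
  - apply ns_scal_distr_r.
Qed.

Lemma dualV_laws : VLaws (dualV X).
Proof.
  constructor; simpl; intros; apply functional_extensionality; intros; ring.
Qed.

Lemma is_dual_add (f g : X -> R) : is_dual f -> is_dual g -> is_dual (fun x => f x + g x).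
Proof.
  intros (fa & fs & M & fM) (ga & gs & M' & gM). split; [|split].
  - intros. rewrite fa, ga. ring.
  - intros. rewrite fs, gs. ring.
  - exists (M + M'). intros x. eapply Rle_trans; [apply Rabs_triang|].
    rewrite Rmult_plus_distr_r. now apply Rplus_le_compat.
Qed.

Lemma dual_le_scal a (f : X -> R) c : dual_le f c -> dual_le (fun x => a * f x) (Rabs a * c).
Proof.
  intros H x. rewrite Rabs_mult, Rmult_assoc.
  apply Rmult_le_compat_l; [apply Rabs_pos|apply H].
Qed.

Lemma is_dual_scal a (f : X -> R) : is_dual f -> is_dual (fun x => a * f x).
Proof.
  intros (fa & fs & M & fM). split; [|split].
  - intros. rewrite fa. ring.
  - intros. rewrite fs. ring.
  - exists (Rabs a * M). now apply dual_le_scal.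
Qed.

Lemma is_dual_zero : is_dual (fun _ : X => 0).
Proof.
  split; [|split]; [intros; ring..|].
  exists 0. intros x. rewrite Rabs_R0. lra.
Qed.

Lemma is_dual_sub (f g : X -> R) : is_dual f -> is_dual g -> is_dual (dsub f g).
Proof.
  intros Hf Hg. replace (dsub f g) with (fun x => f x + -1 * g x).
  - apply is_dual_add; [exact Hf|now apply is_dual_scal].
  - apply functional_extensionality; intros x. unfold dsub. ring.
Qed.

Lemma dual_le_mon (f : X -> R) c d : dual_le f c -> c <= d -> dual_le f d.
Proof.
  intros H Hcd x. eapply Rle_trans; [apply H|].
  apply Rmult_le_compat_r; [apply ns_norm_nonneg|exact Hcd].
Qed.

Lemma dual_complete (u : nat -> X -> R) : (forall n, is_dual (u n)) ->
  (forall eps, 0 < eps -> exists N, forall n m, (N <= n)%nat -> (N <= m)%nat ->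
     dual_le (dsub (u n) (u m)) eps) ->
  exists f, is_dual f /\
    forall eps, 0 < eps -> exists N, forall n, (N <= n)%nat -> dual_le (dsub (u n) f) eps.
Proof.
  intros Hu Hc.
  assert (Hpt : forall x, exists l, Un_cv (fun n => u n x) l).
  { intros x. pose proof (ns_norm_nonneg x) as Hx.
    destruct (R_complete (fun n => u n x)) as [l Hl]; [|eauto].
    intros eps He. destruct (Hc (eps / (ns_norm x + 1))) as [N HN].
    { apply Rdiv_lt_0_compat; lra. }
    exists N. intros n m Hn Hm. unfold Rdist.
    eapply Rle_lt_trans; [exact (HN n m Hn Hm x)|].
    apply (Rmult_lt_reg_r (ns_norm x + 1)); [lra|].
    replace (eps / (ns_norm x + 1) * ns_norm x * (ns_norm x + 1)) with (eps * ns_norm x)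
      by (field; lra). nra. }
  set (f x := proj1_sig (constructive_indefinite_description _ (Hpt x))).
  assert (Hf : forall x, Un_cv (fun n => u n x) (f x)) by
    (intros x; apply (proj2_sig (constructive_indefinite_description _ (Hpt x)))).
  clearbody f.
  assert (Hcv : forall eps, 0 < eps -> exists N, forall n, (N <= n)%nat -> dual_le (dsub (u n) f) eps).
  (* [N] comes from the uniform Cauchy condition and is independent of [x]; only the comparison
     index [N + M] depends on the point. *)
  { intros eps He. destruct (Hc eps He) as [N HN]. exists N. intros n Hn x.
    apply Rnot_lt_le. intros Hlt.
    destruct (Hf x (Rabs (dsub (u n) f x) - eps * ns_norm x)) as [M HM]; [lra|].
    specialize (HM (N + M)%nat ltac:(lia)). specialize (HN n (N + M)%nat Hn ltac:(lia) x).
    unfold Rdist, dsub in *.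
    pose proof (Rabs_triang (u n x - u (N + M)%nat x) (u (N + M)%nat x - f x)) as Ht.
    replace (u n x - u (N + M)%nat x + (u (N + M)%nat x - f x)) with (u n x - f x) in Ht by ring.
    lra. }
  exists f. split; [|exact Hcv]. split; [|split].
  - intros x y. apply (UL_sequence (fun n => u n (ns_add x y))); [apply Hf|].
    intros eps He. destruct (CV_plus _ _ _ _ (Hf x) (Hf y) eps He) as [N HN].
    exists N. intros n Hn. rewrite (proj1 (Hu n)). now apply HN.
  - intros a x. apply (UL_sequence (fun n => u n (ns_scal a x))); [apply Hf|].
    intros eps He.
    assert (Ha : Un_cv (fun _ => a) a).
    { intros e Hee. exists O. intros. unfold Rdist. rewrite Rminus_diag, Rabs_R0. lra. }
    destruct (CV_mult _ _ _ _ Ha (Hf x) eps He) as [N HN].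
    exists N. intros n Hn. rewrite (proj1 (proj2 (Hu n))). now apply HN.
  - destruct (Hcv 1 Rlt_0_1) as [N HN]. destruct (Hu N) as (_ & _ & M & HM).
    exists (M + 1). intros x. specialize (HN N (le_n N) x). specialize (HM x).
    unfold dsub in HN.
    pose proof (Rabs_triang (u N x) (- (u N x - f x))) as Ht. rewrite Rabs_Ropp in Ht.
    replace (u N x + - (u N x - f x)) with (f x) in Ht by ring. lra.
Qed.

End NormedSpaces.

Definition gauged_space (X : NormedSpace) (HX : is_Banach X) : Gauged.
Proof.
  refine {| gV := nsV X; gL := nsV_laws; gN := fun x r => ns_norm (x : X) < r |}; simpl.
  - intros z r H. pose proof (@ns_norm_nonneg X z). lra.
  - intros. lra.
  - intros. now rewrite ns_norm_zero.
  - intros x y r s Hx Hy. pose proof (ns_norm_triangle _ x y). lra.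
  - intros t x r Ht Hx. rewrite ns_norm_scal.
    apply Rmult_lt_compat_l; [now apply Rabs_pos_lt|exact Hx].
  - intros x Hx. apply ns_norm_eq0. apply Rle_antisym; [|apply ns_norm_nonneg].
    apply le_epsilon. intros eps He. specialize (Hx eps He). lra.
  - intros u _ Hu. destruct (HX u) as [l Hl].
    + intros eps He. destruct (Hu eps He) as [N HN]. exists N. intros n m Hn Hm.
      unfold ns_sub. rewrite ns_opp_scal. now apply HN.
    + exists l. split; [exists (ns_norm l + 1); lra|].
      intros eps He. destruct (Hl eps He) as [N HN]. exists N. intros n Hn.
      specialize (HN n Hn). unfold ns_sub in HN. now rewrite ns_opp_scal in HN.
Defined.

(** Positivity of the radius is required explicitly: over the zero space [dual_le] holds with
    negative constants. *)
Definition gauged_dual (X : NormedSpace) : Gauged.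
Proof.
  refine {| gV := dualV X; gL := dualV_laws;
            gN := fun f r => 0 < r /\ is_dual f /\ dual_lt f r |}; simpl.
  - tauto.
  - intros f r s (Hr & Hf & c & Hc & Hfc) Hrs. split; [lra|split; [exact Hf|]].
    exists c. split; [lra|exact Hfc].
  - intros r Hr. split; [exact Hr|split; [apply is_dual_zero|]].
    exists 0. split; [exact Hr|]. intros x. rewrite Rabs_R0. lra.
  - intros f g r s (Hr & Hf & c & Hc & Hfc) (Hs & Hg & d & Hd & Hgd).
    split; [lra|split; [now apply is_dual_add|]]. exists (c + d). split; [lra|].
    intros x. eapply Rle_trans; [apply Rabs_triang|].
    rewrite Rmult_plus_distr_r. now apply Rplus_le_compat.
  - intros t f r Ht (Hr & Hf & c & Hc & Hfc). pose proof (Rabs_pos_lt t Ht).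
    split; [now apply Rmult_lt_0_compat|split; [now apply is_dual_scal|]].
    exists (Rabs t * c). split; [now apply Rmult_lt_compat_l|now apply dual_le_scal].
  - intros f Hf. apply functional_extensionality. intros x.
    pose proof (@ns_norm_nonneg X x) as Hx.
    apply NNPP. intros Hn. apply Rabs_pos_lt in Hn.
    destruct (Hf (Rabs (f x) / (ns_norm x + 1))) as (Hr & _ & c & Hc & Hfc).
    { apply Rdiv_lt_0_compat; lra. }
    apply (dual_le_mon _ _ _) with (2 := Rlt_le _ _ Hc) in Hfc. specialize (Hfc x).
    apply (Rmult_le_compat_r (ns_norm x + 1)) in Hfc; [|lra].
    replace (Rabs (f x) / (ns_norm x + 1) * ns_norm x * (ns_norm x + 1))
      with (Rabs (f x) * ns_norm x) in Hfc by (field; lra). nra.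
  - intros u Hud Hu. destruct (dual_complete u) as (f & Hf & Hfu).
    + intros n. now destruct (Hud n) as (r & _ & H & _).
    + intros eps He. destruct (Hu eps He) as [N HN]. exists N. intros n m Hn Hm.
      destruct (HN n m Hn Hm) as (_ & _ & c & Hc & Hle).
      intros x. eapply Rle_trans; [|apply (dual_le_mon _ _ _ Hle (Rlt_le _ _ Hc))].
      right. unfold vsub, dsub; simpl. f_equal. ring.
    + exists f. split.
      * destruct Hf as (fa & fs & M & HM). exists (Rabs M + 1).
        pose proof (Rabs_pos M). pose proof (Rle_abs M).
        split; [lra|split; [split; eauto|exists M; split; [lra|exact HM]]].
      * intros eps He. destruct (Hfu (eps / 2)) as [N HN]; [lra|].
        exists N. intros n Hn. split; [exact He|].
        replace (fun x => u n x + -1 * f x) with (dsub (u n) f).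
        -- split; [apply is_dual_sub; [|exact Hf]|exists (eps / 2); split; [lra|now apply HN]].
           now destruct (Hud n) as (r & _ & H & _).
        -- apply functional_extensionality. intros x. unfold dsub. ring.
Defined.

Lemma prodV_laws (V W : VOps) : VLaws V -> VLaws W -> VLaws (prodV V W).
Proof.
  intros [] []. constructor; simpl; intros; f_equal; auto.
  - destruct x; simpl; f_equal; auto.
  - destruct x; simpl; f_equal; auto.
Qed.

(** The gauge of the maximum norm, matching [Z_norm_lt]. *)
Definition gauged_prod (V W : Gauged) : Gauged.
Proof.
  refine {| gV := prodV V W; gL := prodV_laws V W (gL V) (gL W);
            gN := fun p r => gN (fst p : V) r /\ gN (snd p : W) r |}; simpl.
  - intros z r [H _]. exact (gN_pos _ _ _ H).
  - intros z r s [H1 H2] Hrs. split; eapply gN_mon; eauto.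
  - intros r Hr. split; now apply gN_zero.
  - intros x y r s [] []. split; now apply gN_add.
  - intros t x r Ht []. split; now apply gN_scal.
  - intros [x y] H. f_equal; apply gN_sep; intros r Hr; now apply (H r Hr).
  - intros u Hud Hu.
    destruct (gN_complete V (fun n => fst (u n))) as (l & [r Hr] & Hl).
    { intros n. destruct (Hud n) as [s Hs]. exists s. apply Hs. }
    { intros eps He. destruct (Hu eps He) as [N HN]. exists N. intros; now apply HN. }
    destruct (gN_complete W (fun n => snd (u n))) as (m & [s Hs] & Hm).
    { intros n. destruct (Hud n) as [s Hs]. exists s. apply Hs. }
    { intros eps He. destruct (Hu eps He) as [N HN]. exists N. intros; now apply HN. }
    exists (l, m). split.
    + pose proof (gN_pos _ _ _ Hr). pose proof (gN_pos _ _ _ Hs).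
      exists (r + s). split; eapply gN_mon; eauto; lra.
    + intros eps He. destruct (Hl eps He) as [N HN]. destruct (Hm eps He) as [M HM].
      exists (N + M)%nat. intros n Hn. split; [apply HN|apply HM]; lia.
Defined.

(** * Operators of Gossez type (D) and representative functions *)

Section MonotoneOperators.
Context {X : NormedSpace} (HX0 : nonzero_space X).

Lemma dual_le_nonneg (f : X -> R) c : dual_le f c -> 0 <= c.
Proof.
  destruct HX0 as [x Hx]. intros H. specialize (H x).
  pose proof (Rabs_pos (f x)). pose proof (ns_norm_nonneg x).
  destruct (Req_dec (ns_norm x) 0) as [E|E]; [now apply ns_norm_eq0 in E|].
  apply Rnot_lt_le. intros Hc. nra.
Qed.

Lemma bidual_sub (xss : (X -> R) -> R) f g : is_bidual xss -> is_dual f -> is_dual g ->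
  xss (dsub f g) = xss f - xss g.
Proof.
  intros (xa & xs & _) Hf Hg.
  replace (dsub f g) with (fun x => f x + -1 * g x).
  - rewrite xa, xs; auto using is_dual_scal. ring.
  - apply functional_extensionality; intros x. unfold dsub. ring.
Qed.

(** Either some graph point already gives a negative value, or [(xss, f)] lies in Gossez's closure
    and type (D) supplies a bounded net with [fi] tending to [f] in norm, along which both terms
    tend to 0. Equivalently, the Fitzpatrick function extended to the bidual dominates the
    coupling. *)
Lemma gossez_D_negative_infimum (S : Op X) xss f eps :
  is_gossez_D S -> is_bidual xss -> is_dual f -> 0 < eps ->
  exists y g, S y g /\ xss (dsub f g) - dsub f g y < eps.
Proof.
  intros [[[Sd _] _] HD] Hx Hf He.
  destruct (classic (gossez_closure S xss f)) as [Hc|Hn].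
  - destruct (HD xss f Hx Hf Hc) as (I & le & xi & fi & _ & Hrefl & _ & _ & HS & [M HM] & _ & Hcv).
    destruct Hx as (xa & xs & K & HK).
    set (q := eps / (Rabs K + Rabs M + 1)).
    pose proof (Rabs_pos K). pose proof (Rabs_pos M).
    assert (Hq : 0 < q) by (apply Rdiv_lt_0_compat; lra).
    destruct (Hcv q Hq) as [i Hi]. specialize (Hi i (Hrefl i)).
    exists (xi i), (fi i). split; [apply HS|].
    assert (Hfi : dual_le (dsub f (fi i)) q).
    { intros x. replace (dsub f (fi i) x) with (- dsub (fi i) f x) by (unfold dsub; ring).
      rewrite Rabs_Ropp. apply Hi. }
    assert (Hd : is_dual (dsub f (fi i))) by (apply is_dual_sub; eauto).
    pose proof (HK _ _ Hd Hfi) as H1. specialize (Hfi (xi i)).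
    destruct (HM i) as [Hxi _].
    pose proof (Rle_abs (xss (dsub f (fi i)))).
    pose proof (Rle_abs (- dsub f (fi i) (xi i))). rewrite Rabs_Ropp in *.
    pose proof (Rle_abs K). pose proof (Rle_abs M).
    assert (Heq : (Rabs K + Rabs M + 1) * q = eps) by (unfold q; field; lra).
    assert (q * ns_norm (xi i) <= q * Rabs M) by (apply Rmult_le_compat_l; lra).
    assert (K * q <= Rabs K * q) by (apply Rmult_le_compat_r; lra).
    lra.
  - unfold gossez_closure in Hn.
    apply not_all_ex_not in Hn as [y Hn]. apply not_all_ex_not in Hn as [g Hn].
    apply imply_to_and in Hn as [HS Hn]. exists y, g. split; [exact HS|lra].
Qed.

(** Every point is monotonically related to an empty graph, so maximality would put [(0, 0)] into
    it. *)
Lemma gossez_D_nonempty (S : Op X) : is_gossez_D S -> exists x f, S x f.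
Proof.
  intros [[_ Hmax] _]. apply NNPP. intros Hn. apply Hn.
  exists ns_zero, (fun _ => 0). apply Hmax; [apply is_dual_zero|].
  intros y g H. contradiction Hn; eauto.
Qed.

(* Convexity of h along the segment from a point of its domain to a point of the graph,
   where h equals the coupling, in the limit t -> 0. *)
Lemma fitzpatrick_le (S : Op X) h x f r y g : is_monotone S -> is_representative S h ->
  is_dual f -> h x f = Fin r -> S y g -> f y + g x - g y <= r.
Proof.
  intros [Sd _] (Hconv & _ & Hge & Heq) Hf Hh HS.
  pose proof (Sd _ _ HS) as Hg.
  assert (H : forall t, 0 < t < 1 -> f y + g x - g y - r <= t * (f y + g x - f x - g y)).
  { intros t Ht. pose proof (Hconv x f y g t Hf Hg Ht) as Hc.
    rewrite Hh, (Heq _ _ HS) in Hc.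
    pose proof (Hge (ns_add (ns_scal t x) (ns_scal (1 - t) y)) (fun z => t * f z + (1 - t) * g z)
      (is_dual_add _ _ (is_dual_scal _ _ Hf) (is_dual_scal _ _ Hg))) as Hl.
    destruct (h (ns_add _ _) _) as [v|]; [|destruct Hc]. simpl in Hc, Hl.
    destruct Hf as (fa & fs & _). destruct Hg as (ga & gs & _).
    rewrite fa, ga, !fs, !gs in Hl.
    apply (Rmult_le_reg_l t); [lra|]. nra. }
  apply Rnot_lt_le. intros Hlt.
  set (c := f y + g x - f x - g y) in *. set (e := f y + g x - g y - r) in *.
  assert (He : 0 < e) by (unfold e; lra).
  pose proof (Rabs_pos c). pose proof (Rle_abs c).
  (* Small enough for [t < 1] and [t * c < e], against the instance [e <= t * c] of [H]. *)
  set (t := e / (2 * (Rabs c + e + 1))).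
  assert (Ht : 0 < t) by (apply Rdiv_lt_0_compat; lra).
  assert (E : t * (2 * (Rabs c + e + 1)) = e) by (unfold t; field; lra).
  assert (t < 1) by nra.
  specialize (H t ltac:(lra)). nra.
Qed.

(* The perturbation (x + t xss, f + t p) changes the Fitzpatrick function by t alpha, and the
   coupling by t (p x + xss f) with no quadratic term because xss p = 0; both signs of t
   then force equality. *)
Lemma functional_constant_on_dom (S : Op X) h xss p alpha x f r :
  is_gossez_D S -> is_representative S h -> is_bidual xss -> is_dual p -> xss p = 0 ->
  (forall y g, S y g -> p y + xss g = alpha) ->
  is_dual f -> h x f = Fin r -> p x + xss f = alpha.
Proof.
  intros HS Hh Hx Hp Hxp Hconst Hf Hr.
  assert (Hb : forall t, t * (p x + xss f - alpha) <= r - f x).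
  { intros t. apply le_epsilon. intros eps He.
    set (ft := fun z => f z + t * p z).
    assert (Hft : is_dual ft) by (apply is_dual_add; auto using is_dual_scal).
    destruct Hx as (xa & xs & K & HK).
    (* The bidual element [x + t xss] is paired with [f + t p]. After expansion, [Hconst] replaces
       [p y + xss g] by [alpha], and [fitzpatrick_le] bounds [f y + g x - g y] by [r]. *)
    destruct (gossez_D_negative_infimum S (fun g => g x + t * xss g) ft eps HS) as (y & g & Hy & Hlt);
      auto.
    - split; [|split].
      + intros u v Hu Hv. rewrite xa; auto. ring.
      + intros a u Hu. rewrite xs; auto. ring.
      + exists (ns_norm x + Rabs t * K). intros u c Hu Hc.
        eapply Rle_trans; [apply Rabs_triang|]. rewrite Rabs_mult, Rmult_plus_distr_r.
        apply Rplus_le_compat; [rewrite Rmult_comm; apply Hc|].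
        rewrite Rmult_assoc. apply Rmult_le_compat_l; [apply Rabs_pos|now apply HK].
    - assert (Hg : is_dual g) by (eapply HS; exact Hy).
      rewrite bidual_sub in Hlt; [|split; eauto|exact Hft|exact Hg].
      unfold ft in Hlt at 2. rewrite xa, xs, Hxp in Hlt; auto using is_dual_scal.
      unfold dsub, ft in Hlt. specialize (Hconst y g Hy).
      pose proof (fitzpatrick_le S h x f r y g (proj1 (proj1 HS)) Hh Hf Hr Hy).
      nra. }
  apply NNPP. intros Hn. set (c := p x + xss f - alpha) in *.
  assert (Hc : c <> 0) by (unfold c; lra).
  (* A linear function of [t] bounded above on the whole line is zero; this [t] gives it a value
     exceeding the bound. *)
  specialize (Hb ((Rabs (r - f x) + 1) / c)).
  replace ((Rabs (r - f x) + 1) / c * c) with (Rabs (r - f x) + 1) in Hb by (field; auto).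
  pose proof (Rle_abs (r - f x)). lra.
Qed.

Lemma convex_combination_finite h x1 f1 x2 f2 r1 r2 t : is_convex_fun h ->
  is_dual f1 -> is_dual f2 -> 0 < t < 1 -> h x1 f1 = Fin r1 -> h x2 f2 = Fin r2 ->
  exists r : R, h (ns_add (ns_scal t x1) (ns_scal (1 - t) x2))
              (fun z : X => t * f1 z + (1 - t) * f2 z) = Fin r /\ r <= t * r1 + (1 - t) * r2.
Proof.
  intros Hc H1 H2 Ht E1 E2. specialize (Hc x1 f1 x2 f2 t H1 H2 Ht). rewrite E1, E2 in Hc.
  destruct (h (ns_add _ _) _) as [r|]; [|destruct Hc]. exists r. auto.
Qed.

End MonotoneOperators.

(** * The qualification sets *)

Lemma directions_setsub {V : VOps} (HV : VLaws V) (D M : V -> Prop) a b m :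
  M vzero -> D a -> D b -> M m -> directions (setsub D M) a (vsub (vsub b a) m).
Proof.
  intros M0 Ha Hb Hm. apply aff_incl; [exact HV|]. exists b, m.
  split; [exact Hb|split; [exact Hm|]]. module_with HV; ring.
Qed.

Lemma setsub_base {V : VOps} (HV : VLaws V) (D M : V -> Prop) a :
  M vzero -> D a -> setsub D M a.
Proof. intros M0 Ha. exists a, vzero. repeat split; auto. module_with HV; ring. Qed.

(** Directions of a set in the normed part have finite gauge [s], so steps of length up to [r / s]
    remain in the ball. *)
Lemma interior_icr {V : Gauged} (E : V -> Prop) u r : (forall z, E z -> gdom z) -> E u ->
  0 < r -> (forall w, aff E w -> gN (vsub w u) r -> E w) -> icr E u.
Proof.
  intros HE Hu Hr Hint x Hx. pose proof (proj1 (aff_setsub (gL V) E u x Hu) Hx) as Hw.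
  pose proof (directions_subspace (gL V) E u (aff_incl (gL V) _ _ Hu)) as HW.
  assert (Hxd : gdom x).
  { apply (subspace_eq _ (vsub x vzero)); [|vmod_ring].
    apply (aff_sub_mem (gL V) _ (setsub E E)); [apply gdom_subspace| |exact Hx].
    intros z (a & b & Ha & Hb & ->). apply subspace_sub; [apply gdom_subspace| |apply gdom_subspace].
    apply (subspace_sub _ a b); auto using gdom_subspace. }
  destruct Hxd as [s Hs]. pose proof (gN_pos _ _ _ Hs).
  exists (r / s). split; [now apply Rdiv_lt_0_compat|].
  intros lam Hlam. apply Hint.
  - apply HW. exact Hw.
  - apply (gN_eq (vscal lam x)); [|vmod_ring].
    eapply gN_scal_le; [exact Hs| |exact Hr]. rewrite Rabs_pos_eq by lra.
    replace r with (r / s * s) by (field; lra).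
    apply Rmult_le_compat_r; lra.
Qed.

Section Qualification.
Context (X Y : NormedSpace) (HX : is_Banach X) (HY : is_Banach Y) (HX0 : nonzero_space X)
  (HY0 : nonzero_space Y) (S : Op X) (T : Op Y) (HS : is_gossez_D S) (HT : is_gossez_D T)
  (hS : X -> (X -> R) -> Rinf) (hT : Y -> (Y -> R) -> Rinf)
  (HhS : is_representative S hS) (HhT : is_representative T hT)
  (A : X -> Y) (HA : is_bounded_linear_map A).

Definition gauged_Z : Gauged :=
  gauged_prod (gauged_prod (gauged_space Y HY) (gauged_dual Y)) (gauged_dual X).

Let V : VOps := Zsp X Y.
Let HV : VLaws V := gL gauged_Z.
Let E0 : V -> Prop := setsub (GT_RS S T) (imA_Delta A).
Let E1 : V -> Prop := setsub (coGT_coRS S T) (imA_Delta A).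
Let E2 : V -> Prop := setsub (domT_prS hS hT) (imA_Delta A).

Lemma A_zero : A ns_zero = ns_zero.
Proof. rewrite <- (ns_scal_0 ns_zero), (proj1 (proj2 HA)). apply ns_scal_0. Qed.

Lemma is_dual_adjoint g : is_dual g -> is_dual (fun x => g (A x)).
Proof.
  destruct HA as (Aa & As & M & AM). intros (ga & gs & K & gK). split; [|split].
  - intros. now rewrite Aa, ga.
  - intros. now rewrite As, gs.
  - exists (Rabs K * Rabs M). intros x. eapply Rle_trans; [apply gK|].
    apply Rle_trans with (Rabs K * ns_norm (A x)).
    + apply Rmult_le_compat_r; [apply ns_norm_nonneg|apply Rle_abs].
    + rewrite Rmult_assoc. apply Rmult_le_compat_l; [apply Rabs_pos|].
      eapply Rle_trans; [apply AM|].
      apply Rmult_le_compat_r; [apply ns_norm_nonneg|apply Rle_abs].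
Qed.

Lemma imA_Delta_zero : imA_Delta A (vzero : V).
Proof.
  exists ns_zero, (fun _ => 0). split; [apply is_dual_zero|]. now rewrite A_zero.
Qed.

Lemma imA_Delta_inZ z : imA_Delta A z -> inZ z.
Proof. intros (x & g & Hg & ->). split; simpl; auto using is_dual_adjoint. Qed.

Lemma inZ_gdom (z : V) : inZ z <-> gdom (z : gauged_Z).
Proof.
  destruct z as [[y g] f]. unfold inZ; simpl. split.
  - intros [(ga & gs & M & gM) (fa & fs & K & fK)].
    exists (ns_norm y + Rabs M + Rabs K + 1).
    pose proof (ns_norm_nonneg y). pose proof (Rabs_pos M). pose proof (Rabs_pos K).
    pose proof (Rle_abs M). pose proof (Rle_abs K).
    split; [split|]; simpl; [lra| |]; (split; [lra|]).
    + split; [split; eauto|]. exists M. split; [lra|exact gM].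
    + split; [split; eauto|]. exists K. split; [lra|exact fK].
  - intros [r [[_ (_ & Hg & _)] (_ & Hf & _)]]. auto.
Qed.

Lemma gN_Z_norm (z : V) r : gN (z : gauged_Z) r -> Z_norm_lt z r.
Proof. intros [[H1 (_ & _ & H2)] (_ & _ & H3)]. repeat split; assumption. Qed.

Lemma Z_norm_gN (z : V) r : inZ z -> 0 < r -> Z_norm_lt z r -> gN (z : gauged_Z) r.
Proof. intros [Hg Hf] Hr (H1 & H2 & H3). repeat split; try assumption; apply Hg || apply Hf. Qed.

Lemma inZ_sub (a b : V) : inZ a -> inZ b -> inZ (vsub a b).
Proof.
  intros Ha Hb. apply inZ_gdom in Ha. apply inZ_gdom in Hb. apply inZ_gdom.
  exact (subspace_sub (V := gauged_Z) _ _ _ gdom_subspace Ha Hb).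
Qed.

Lemma Z_closed_gclosed (D : V -> Prop) : Z_closed D -> gclosed (V := gauged_Z) D.
Proof.
  intros H u z Hu Hz Hcv. apply (H u z Hu); [now apply inZ_gdom|].
  intros eps He. destruct (Hcv eps He) as [N HN]. exists N. intros n Hn.
  apply gN_Z_norm. exact (HN n Hn).
Qed.

(** * Comparison of the three sets and of their affine hulls *)

Lemma GT_RS_inhabited : exists y0 g0 x0 f0, T y0 g0 /\ S x0 f0.
Proof.
  destruct (gossez_D_nonempty S HS) as (x0 & f0 & H0).
  destruct (gossez_D_nonempty T HT) as (y0 & g0 & H1). eauto 6.
Qed.

Lemma GT_RS_coGT_coRS z : GT_RS S T z -> coGT_coRS S T z.
Proof.
  intros (y & g & f & Ht & Hs & ->). exists (y, g), f.
  split; [|split; [|reflexivity]].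
  - apply co_incl; [apply prodV_laws; [apply nsV_laws|apply dualV_laws]|exact Ht].
  - apply co_incl; [apply dualV_laws|exact Hs].
Qed.

(** Representative functions are finite on the graphs and have convex domains; the projection to the
    dual stays convex because the points of X are combined with the same weights. *)
Lemma coGT_coRS_domT_prS z : coGT_coRS S T z -> domT_prS hS hT z.
Proof.
  destruct HS as [[[Sd _] _] _]. destruct HT as [[[Td _] _] _].
  destruct HhS as (Sc & _ & _ & Seq). destruct HhT as (Tc & _ & _ & Teq).
  intros ([y g] & f & Hp & Hf & ->).
  apply (co_convex_set (prodV_laws _ _ nsV_laws dualV_laws) _
    (fun q : prodV (nsV Y) (dualV Y) => is_dual (snd q) /\ exists r, hT (fst q) (snd q) = Fin r)) in Hp.
  - apply (co_convex_set dualV_laws _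
      (fun f : dualV X => is_dual f /\ exists x r, hS x f = Fin r)) in Hf.
    + exists y, g, f. simpl in Hp. tauto.
    + intros f1 f2 t [H1 (x1 & r1 & E1')] [H2 (x2 & r2 & E2')] Ht. split.
      * apply is_dual_add; now apply is_dual_scal.
      * destruct (convex_combination_finite hS _ _ _ _ _ _ t Sc H1 H2 Ht E1' E2') as (r & Hr & _).
        eauto.
    + intros f1 [x Hx]. split; [eauto|]. exists x, (f1 x). auto.
  - intros [y1 g1] [y2 g2] t [H1 (r1 & E1')] [H2 (r2 & E2')] Ht. simpl in *. split.
    + apply is_dual_add; now apply is_dual_scal.
    + destruct (convex_combination_finite hT _ _ _ _ _ _ t Tc H1 H2 Ht E1' E2') as (r & Hr & _).
      eauto.
  - intros [y1 g1] H1. simpl in *. split; [eauto|]. exists (g1 y1). auto.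
Qed.

Lemma setsub_mono (D D' M : V -> Prop) z : (forall x, D x -> D' x) -> setsub D M z -> setsub D' M z.
Proof. intros H (a & b & Ha & Hb & ->). exists a, b. auto. Qed.

(** With one factor frozen at [a0], the directions lying in the other factor form a subspace, which
    therefore absorbs convex combinations taken in that factor. The two slices and the direction
    [- l] add up to [z - a0]. *)
Lemma coGT_coRS_aff z : E1 z -> aff E0 z.
Proof.
  intros (a & l & ([y g] & f & Hp & Hf & ->) & Hl & ->).
  destruct GT_RS_inhabited as (y0 & g0 & x0 & f0 & H0 & H1).
  set (a0 := ((y0, g0), f0) : V).
  assert (Ha0 : GT_RS S T a0) by (exists y0, g0, f0; eauto).
  pose proof (setsub_base HV _ _ a0 imA_Delta_zero Ha0) as Hb0.
  pose proof (directions_subspace HV E0 a0 (aff_incl HV _ _ Hb0)) as HW.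
  assert (Hdir : forall b m, GT_RS S T b -> imA_Delta A m ->
    directions E0 a0 (vsub (vsub b a0) m)).
  { intros b m Hb Hm. apply directions_setsub; auto using imA_Delta_zero. }
  apply (aff_directions HV E0 a0).
  set (LP := prodV_laws _ _ (@nsV_laws Y) (@dualV_laws Y)).
  assert (HP : directions E0 a0 (vsub (V := prodV (nsV Y) (dualV Y)) (y, g) (y0, g0), vzero)).
  { apply (aff_sub_mem LP (fun q => directions E0 a0 (q, vzero)) _ (y0, g0)
      (y, g)) with (3 := co_aff _ _ Hp).
    - destruct HW as (W0 & Wadd & Wscal). split; [exact W0|split].
      + intros p q Hp' Hq. eapply subspace_eq; [exact (Wadd _ _ Hp' Hq)|].
        simpl. f_equal. apply functional_extensionality; intros; ring.
      + intros c p Hp'. eapply subspace_eq; [exact (Wscal c _ Hp')|].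
        simpl. f_equal. apply functional_extensionality; intros; ring.
    - intros [y1 g1] Hy1. eapply subspace_eq.
      + apply (Hdir ((y1, g1), f0) vzero); [exists y1, g1, f0; eauto|apply imA_Delta_zero].
      + transitivity (vsub (((y1, g1), f0) : V) a0); [module_with HV; ring|].
        unfold vsub; simpl. f_equal. apply functional_extensionality; intros; ring. }
  assert (HF : directions E0 a0 (vzero, vsub (V := dualV X) f f0)).
  { apply (aff_sub_mem dualV_laws (fun q => directions E0 a0 (vzero, q)) _ f0 f)
      with (3 := co_aff _ _ Hf).
    - destruct HW as (W0 & Wadd & Wscal). split; [exact W0|split].
      + intros p q Hp' Hq. eapply subspace_eq; [exact (Wadd _ _ Hp' Hq)|].
        change ((vadd vzero vzero, vadd p q) = (vzero, vadd p q) :> V). f_equal.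
        module_with LP; ring.
      + intros c p Hp'. eapply subspace_eq; [exact (Wscal c _ Hp')|].
        change ((vscal c vzero, vscal c p) = (vzero, vscal c p) :> V). f_equal.
        module_with LP; ring.
    - intros f1 [x1 Hx1]. eapply subspace_eq.
      + apply (Hdir ((y0, g0), f1) vzero); [exists y0, g0, f1; eauto|apply imA_Delta_zero].
      + transitivity (vsub (((y0, g0), f1) : V) a0); [module_with HV; ring|].
        change ((vsub (V := prodV (nsV Y) (dualV Y)) (y0, g0) (y0, g0), vsub (V := dualV X) f1 f0)
          = (vzero, vsub (V := dualV X) f1 f0) :> V). f_equal.
        module_with LP; ring. }
  pose proof (Hdir a0 l Ha0 Hl) as HL.
  eapply subspace_eq; [exact (proj1 (proj2 HW) _ _ HL (proj1 (proj2 HW) _ _ HP HF))|].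
  transitivity (vadd (vsub (vsub a0 a0) l) (vsub (V := V) ((y, g), f) a0)).
  - f_equal.
    change ((vadd (vsub (V := prodV (nsV Y) (dualV Y)) (y, g) (y0, g0)) vzero,
             vadd vzero (vsub (V := dualV X) f f0)) =
            (vsub (V := prodV (nsV Y) (dualV Y)) (y, g) (y0, g0), vsub (V := dualV X) f f0) :> V).
    f_equal; [module_with LP; ring|module_with (@dualV_laws X); ring].
  - change (vadd (vsub (vsub a0 a0) l) (vsub (V := V) ((y, g), f) a0) =
      vsub (vsub (V := V) ((y, g), f) l) a0).
    module_with HV; ring.
Qed.

Lemma E2_inZ z : E2 z -> inZ z.
Proof.
  intros (a & l & (y & g & f & Hg & Hf & _ & _ & ->) & Hl & ->).
  apply (inZ_sub ((y, g), f) l); [split; assumption|now apply imA_Delta_inZ].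
Qed.

Lemma domT_prS_aff z : Z_closed (aff E1) -> E2 z -> aff E1 z.
Proof.
  intros Hcl Hz. apply NNPP. intros Hn.
  destruct GT_RS_inhabited as (y0 & g0 & x0 & f0 & H0 & H1).
  set (a0 := ((y0, g0), f0) : V).
  assert (HG : forall y g f x, T y g -> S x f -> coGT_coRS S T ((y, g), f)).
  { intros y g f x Hy Hx. apply GT_RS_coGT_coRS. exists y, g, f. eauto. }
  assert (Ha0 : coGT_coRS S T a0) by now apply (HG _ _ _ x0).
  pose proof (setsub_base HV _ _ a0 imA_Delta_zero Ha0) as Hb0.
  pose proof (directions_subspace HV E1 a0 (aff_incl HV _ _ Hb0)) as HW.
  assert (Sd : forall x f, S x f -> is_dual f) by apply HS.
  assert (Td : forall y g, T y g -> is_dual g) by apply HT.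
  assert (Ha0Z : inZ a0) by (split; simpl; eauto).
  assert (Hdir : forall b m, coGT_coRS S T b -> imA_Delta A m ->
    directions E1 a0 (vsub (vsub b a0) m)).
  { intros b m Hb Hm. apply directions_setsub; auto using imA_Delta_zero. }
  assert (HzZ : inZ z) by now apply E2_inZ.
  destruct (hahn_banach_separation (V := gauged_Z) (directions E1 a0) (vsub (V := V) z a0))
    as (F & Fadd & Fscal & Fbd & FW & Fz).
  - exact HW.
  - apply Z_closed_gclosed in Hcl. intros u w Hu Hw Hcv.
    apply (Hcl (fun n => vadd (a0 : gauged_Z) (u n))); [exact Hu| |].
    + apply (proj1 (proj2 (@gdom_subspace gauged_Z))); [now apply inZ_gdom|exact Hw].
    + intros eps He. destruct (Hcv eps He) as [N HN]. exists N. intros n Hp.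
      apply (gN_eq _ _ _ (HN n Hp)). module_with HV; ring.
  - apply inZ_gdom. now apply inZ_sub.
  - intros Hw. apply Hn. now apply (aff_directions HV E1 a0).
  - assert (Hd : forall y g f, is_dual g -> is_dual f -> gdom (((y, g), f) : gauged_Z)).
    { intros y g f Hg Hf. apply inZ_gdom. split; assumption. }
    pose proof (@is_dual_zero Y) as HY00. pose proof (@is_dual_zero X) as HX00.
    (* The restrictions of [F] to the coordinate axes give an element of the dual of Y and elements
       of the biduals of Y and X. *)
    set (ys := fun y : Y => F ((y, fun _ => 0), fun _ => 0)).
    set (yss := fun g : Y -> R => F ((ns_zero, g), fun _ => 0)).
    set (xss := fun f : X -> R => F ((ns_zero, fun _ => 0), f)).
    assert (Fsplit : forall y g f, is_dual g -> is_dual f ->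
      F ((y, g), f) = ys y + yss g + xss f).
    { intros y g f Hg Hf. unfold ys, yss, xss.
      assert (Hyd := Hd y _ _ HY00 HX00). assert (Hgd := Hd ns_zero g _ Hg HX00).
      assert (Hfd := Hd ns_zero _ f HY00 Hf).
      assert (Hygd := proj1 (proj2 (@gdom_subspace gauged_Z)) _ _ Hyd Hgd).
      etransitivity; [|exact (eq_trans (Fadd _ _ Hygd Hfd) (f_equal (fun v => v + _) (Fadd _ _ Hyd Hgd)))].
      f_equal. simpl. f_equal; [f_equal|].
      - now rewrite !ns_add_0.
      - apply functional_extensionality; intros; ring.
      - apply functional_extensionality; intros; ring. }
    assert (Fsub : forall a b : V, inZ a -> inZ b -> F (vsub a b) = F a - F b).
    { intros a b Ha Hb. apply inZ_gdom in Ha. apply inZ_gdom in Hb.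
      unfold vsub. change (F (vadd (a : gauged_Z) (vscal (-1) b)) = F a - F b).
      rewrite Fadd, Fscal; [ring|assumption..|].
      now apply (proj2 (proj2 (@gdom_subspace gauged_Z))). }
    assert (FL : forall l, imA_Delta A l -> F l = 0).
    { intros l Hl. pose proof (Hdir a0 l Ha0 Hl) as H.
      pose proof (imA_Delta_inZ l Hl) as HlZ.
      apply FW in H; [|apply inZ_gdom; auto using inZ_sub].
      rewrite !Fsub in H; auto using inZ_sub. lra. }
    assert (FD : forall b, coGT_coRS S T b -> inZ b -> F b = F a0).
    { intros b Hb HbZ. pose proof (Hdir b vzero Hb imA_Delta_zero) as H.
      assert (H0Z : inZ (vzero : V)) by (split; assumption).
      apply FW in H; [|apply inZ_gdom; auto using inZ_sub].
      rewrite !Fsub in H; auto using inZ_sub. rewrite (FL vzero imA_Delta_zero) in H. lra. }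
    assert (Hys0 : ys ns_zero = 0) by (apply (FL vzero), imA_Delta_zero).
    assert (Hyss0 : yss (fun _ => 0) = 0) by (apply (FL vzero), imA_Delta_zero).
    assert (Hxss0 : xss (fun _ => 0) = 0) by (apply (FL vzero), imA_Delta_zero).
    assert (Hadj : forall x g, is_dual g -> ys (A x) + yss g + xss (fun x' => g (A x')) = 0).
    { intros x g Hg. rewrite <- Fsplit by auto using is_dual_adjoint.
      apply FL. exists x, g. auto. }
    assert (HysA : forall x, ys (A x) = 0).
    { intros x. specialize (Hadj x _ HY00). simpl in Hadj. rewrite Hyss0, Hxss0 in Hadj. lra. }
    assert (Hys : is_dual ys).
    { split; [|split].
      - intros y y'. unfold ys. rewrite <- Fadd; try (apply Hd; assumption).
        f_equal. simpl. f_equal; [f_equal|]; apply functional_extensionality; intros; ring.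
      - intros a y. unfold ys. rewrite <- Fscal; try (apply Hd; assumption).
        f_equal. simpl. f_equal; [f_equal|]; apply functional_extensionality; intros; ring.
      (* The gauge is a strict bound on the norm; the slack [eps] turns [Fbd] into the norm bound
         1. *)
      - exists 1. intros y. apply le_epsilon. intros eps He. apply Fbd.
        pose proof (ns_norm_nonneg y).
        apply Z_norm_gN; [split; assumption|lra|]. split; [simpl; lra|].
        split; exists 0; (split; [lra|]); intros x; simpl; rewrite Rabs_R0; lra. }
    assert (Hyss : is_bidual yss).
    { split; [|split].
      - intros f g Hf Hg. unfold yss. rewrite <- Fadd; try (apply Hd; assumption).
        f_equal. simpl. f_equal; [f_equal; now rewrite ns_add_0|].
        apply functional_extensionality; intros; ring.
      - intros a f Hf. unfold yss. rewrite <- Fscal; try (apply Hd; assumption).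
        f_equal. simpl. f_equal; [f_equal|].
        + symmetry. apply (vl_scal_zero (nsV Y) nsV_laws).
        + apply functional_extensionality; intros; ring.
      - exists 1. intros g c Hg Hgc. apply le_epsilon. intros eps He. apply Fbd.
        pose proof (dual_le_nonneg HY0 g c Hgc).
        apply Z_norm_gN; [split; assumption|lra|]. split; [simpl; rewrite ns_norm_zero; lra|].
        split; [exists c; split; [lra|exact Hgc]|].
        exists 0; (split; [lra|]); intros x; simpl; rewrite Rabs_R0; lra. }
    assert (Hxss : is_bidual xss).
    { split; [|split].
      - intros f g Hf Hg. unfold xss. rewrite <- Fadd; try (apply Hd; assumption).
        f_equal. simpl. f_equal. f_equal; [now rewrite ns_add_0|].
        apply functional_extensionality; intros; ring.
      - intros a f Hf. unfold xss. rewrite <- Fscal; try (apply Hd; assumption).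
        f_equal. simpl. f_equal. f_equal.
        + symmetry. apply (vl_scal_zero (nsV Y) nsV_laws).
        + apply functional_extensionality; intros; ring.
      - exists 1. intros f c Hf Hfc. apply le_epsilon. intros eps He. apply Fbd.
        pose proof (dual_le_nonneg HX0 f c Hfc).
        apply Z_norm_gN; [split; assumption|lra|]. split; [simpl; rewrite ns_norm_zero; lra|].
        split; [|exists c; split; [lra|exact Hfc]].
        exists 0; (split; [lra|]); intros x; simpl; rewrite Rabs_R0; lra. }
    assert (Hortho : yss ys = 0).
    (* The relation is tested at [g := ys] itself, whose pullback along [A] vanishes by [HysA]. *)
    { specialize (Hadj ns_zero ys Hys). rewrite A_zero, Hys0 in Hadj.
      replace (fun x' => ys (A x')) with (fun _ : X => 0) in Hadj.
      - rewrite Hxss0 in Hadj. lra.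
      - apply functional_extensionality. intros x. now rewrite HysA. }
    assert (HFa0 : F a0 = ys y0 + yss g0 + xss f0) by (apply Fsplit; eauto).
    destruct Hz as (a & l & (y & g & f & Hg & Hf & (r & Hr) & (x & s & Hs) & ->) & Hl & ->).
    assert (HTc : ys y + yss g = ys y0 + yss g0).
    { apply (functional_constant_on_dom T hT yss ys _ y g r HT HhT); auto.
      intros y1 g1 Hy1. specialize (FD _ (HG _ _ _ _ Hy1 H1)).
      rewrite Fsplit in FD by eauto. rewrite HFa0 in FD.
      enough (ys y1 + yss g1 + xss f0 = ys y0 + yss g0 + xss f0) by lra.
      apply FD. split; simpl; eauto. }
    (* R(S) forgets the point of X, so the direction for [S] is [(xss, 0)], and the orthogonality
       condition reads [xss 0 = 0]. *)
    assert (HSc : 0 + xss f = xss f0).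
    { apply (functional_constant_on_dom S hS xss (fun _ => 0) _ x f s HS HhS); auto.
      intros x1 f1 Hx1. specialize (FD _ (HG _ _ _ _ H0 Hx1)).
      rewrite Fsplit in FD by eauto. rewrite HFa0 in FD.
      enough (ys y0 + yss g0 + xss f1 = ys y0 + yss g0 + xss f0) by lra.
      apply FD. split; simpl; eauto. }
    apply Fz.
    assert (HbZ : inZ (((y, g), f) : V)) by (split; assumption).
    pose proof (imA_Delta_inZ l Hl) as HlZ.
    pose proof (Fsub _ _ (inZ_sub _ _ HbZ HlZ) Ha0Z) as Eza.
    pose proof (eq_trans (Fsub _ _ HbZ HlZ) (f_equal2 Rminus (Fsplit y g f Hg Hf) (FL l Hl))) as Ezl.
    etransitivity; [exact (eq_trans Eza (f_equal2 Rminus Ezl HFa0))|]. lra.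
Qed.

(** * The last set as a linear image of an increasing union of closed convex sets *)

Let ZB : Gauged := gauged_prod gauged_Z
  (gauged_prod (gauged_prod (gauged_space X HX) (gauged_space X HX)) (gauged_dual Y)).

Definition delta_point (x : X) (g : Y -> R) : V := ((A x, g), fun x' => g (A x')).

(** The discarded coordinate is the point of X witnessing membership in the projection of dom h_S;
    the other point of X and [g] parametrise im A x Delta. *)
Definition sum_difference (b : ZB) : gauged_Z :=
  match b with (z, ((_, x), g)) => vsub (V := V) z (delta_point x g) end.

Definition sublevel (n : nat) (b : ZB) : Prop :=
  gdom b /\ match b with (((y, g), f), ((x, _), _)) =>
    Rinf_le (hT y g) (Fin (INR n)) /\ Rinf_le (hS x f) (Fin (INR n)) end.

Lemma sum_difference_image : image sum_difference sublevel = E2.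
Proof.
  apply functional_extensionality. intros z. apply propositional_extensionality. split.
  - intros (n & [[[y g] f] [[x' x] g']] &
      [[r [[[_ (_ & Hg & _)] (_ & Hf & _)] [_ (_ & Hg' & _)]]] [H1 H2]] & ->).
    destruct (hT y g) as [r1|] eqn:E1'; [|destruct H1].
    destruct (hS x' f) as [r2|] eqn:E2'; [|destruct H2].
    exists ((y, g), f), ((A x, g'), fun x' => g' (A x')). split; [|split; [|reflexivity]].
    + exists y, g, f. eauto 8.
    + exists x, g'. auto.
  - intros (a & l & (y & g & f & Hg & Hf & (r1 & H1) & (x' & r2 & H2) & ->) & (x & g' & Hg' & ->) & ->).
    destruct (INR_unbounded (Rmax r1 r2)) as [n Hn].
    exists n, (((y, g), f), ((x', x), g')). split; [split|reflexivity].
    + destruct (proj1 (inZ_gdom ((y, g), f))) as [q Hq]; [split; assumption|].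
      destruct Hg' as (ga & gs & M & gM).
      exists (q + ns_norm x' + ns_norm x + Rabs M + 1).
      pose proof (gN_pos _ _ _ Hq). pose proof (ns_norm_nonneg x).
      pose proof (ns_norm_nonneg x'). pose proof (Rabs_pos M). pose proof (Rle_abs M).
      split; [eapply gN_mon; [exact Hq|lra]|].
      split; [split; simpl; lra|]. split; [lra|]. split; [split; eauto|].
      exists M. split; [lra|exact gM].
    + rewrite H1, H2. pose proof (Rmax_l r1 r2). pose proof (Rmax_r r1 r2). simpl. lra.
Qed.

Lemma sum_difference_add b c :
  sum_difference (vadd b c) = vadd (sum_difference b) (sum_difference c).
Proof.
  destruct b as [z [[x' x] g]]. destruct c as [w [[u' u] k]]. destruct HA as (Aa & _ & _).
  transitivity (vsub (V := V) (vadd z w) (vadd (delta_point x g) (delta_point u k))).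
  - unfold delta_point; simpl. now rewrite Aa.
  - change (vsub (V := V) (vadd z w) (vadd (delta_point x g) (delta_point u k)) =
      vadd (vsub (V := V) z (delta_point x g)) (vsub (V := V) w (delta_point u k))).
    module_with HV; ring.
Qed.

Lemma sum_difference_scal a b : sum_difference (vscal a b) = vscal a (sum_difference b).
Proof.
  destruct b as [z [[x' x] g]]. destruct HA as (_ & As & _).
  transitivity (vsub (V := V) (vscal a z) (vscal a (delta_point x g))).
  - unfold delta_point; simpl. now rewrite As.
  - change (vsub (V := V) (vscal a z) (vscal a (delta_point x g)) =
      vscal a (vsub (V := V) z (delta_point x g))).
    module_with HV; ring.
Qed.

Lemma sum_difference_bounded :
  exists M, 0 < M /\ forall b r, gN b r -> gN (sum_difference b) (M * r).
Proof.
  destruct HA as (_ & _ & M & AM). pose proof (Rabs_pos M). pose proof (Rle_abs M).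
  (* The summand 1 serves [z]; [1 + Rabs M] bounds the three components [A x], [g] and the pullback
     of [g] at once. *)
  exists (1 + (1 + Rabs M)). split; [lra|].
  intros [z [[x' x] g]] r [Hz [[_ Hx] (Hr & Hg & c & Hc & Hgc)]].
  rewrite Rmult_plus_distr_r, Rmult_1_l.
  apply (gN_sub (V := gauged_Z) z (delta_point x g)); [exact Hz|].
  assert (Hr' : 0 < (1 + Rabs M) * r) by nra.
  assert (Hrr : r <= (1 + Rabs M) * r) by nra.
  split; [split|]; simpl in *.
  - eapply Rle_lt_trans; [apply AM|]. pose proof (ns_norm_nonneg x).
    apply Rle_lt_trans with (Rabs M * r); nra.
  - split; [exact Hr'|split; [exact Hg|]]. exists c. split; [lra|exact Hgc].
  - split; [exact Hr'|split; [now apply is_dual_adjoint|]].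
    pose proof (dual_le_nonneg HY0 g c Hgc) as Hc0.
    exists (Rabs M * c). split; [nra|]. intros u.
    eapply Rle_trans; [apply Hgc|]. rewrite (Rmult_comm (Rabs M)), Rmult_assoc.
    apply Rmult_le_compat_l; [exact Hc0|].
    eapply Rle_trans; [apply AM|].
    apply Rmult_le_compat_r; [apply ns_norm_nonneg|assumption].
Qed.

Lemma sublevel_convex n : convex_set (sublevel n).
Proof.
  destruct HhS as (Sc & _). destruct HhT as (Tc & _).
  intros [[[y1 g1] f1] [[x1 u1] k1]] [[[y2 g2] f2] [[x2 u2] k2]] t [D1 [T1 S1]] [D2 [T2 S2]] Ht.
  split; [apply gdom_subspace; now apply gdom_subspace|].
  destruct D1 as [r1 [[[_ (_ & Hg1 & _)] (_ & Hf1 & _)] _]].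
  destruct D2 as [r2 [[[_ (_ & Hg2 & _)] (_ & Hf2 & _)] _]].
  destruct (hT y1 g1) as [p1|] eqn:E1'; [|destruct T1].
  destruct (hT y2 g2) as [p2|] eqn:E2'; [|destruct T2].
  destruct (hS x1 f1) as [q1|] eqn:E3'; [|destruct S1].
  destruct (hS x2 f2) as [q2|] eqn:E4'; [|destruct S2].
  destruct (convex_combination_finite hT _ _ _ _ _ _ t Tc Hg1 Hg2 Ht E1' E2') as (p & Hp & Hpl).
  destruct (convex_combination_finite hS _ _ _ _ _ _ t Sc Hf1 Hf2 Ht E3' E4') as (q & Hq & Hql).
  simpl in *. rewrite Hp, Hq. simpl. split; nra.
Qed.

Lemma sublevel_closed n : gclosed (sublevel n).
Proof.
  destruct HhS as (_ & Sl & _). destruct HhT as (_ & Tl & _).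
  intros u [[[y g] f] [[x' x] k]] Hu Hd Hcv. split; [exact Hd|].
  destruct Hd as [r [[[_ (_ & Hg & _)] (_ & Hf & _)] _]].
  split.
  - apply (Tl (INR n) (fun i => fst (fst (fst (u i)))) (fun i => snd (fst (fst (u i))))).
    + exact Hg.
    + intros i. destruct (Hu i) as [[q [[[_ (_ & H & _)] _] _]] _]. exact H.
    + intros i. destruct (Hu i) as [_ H]. destruct (u i) as [[[a b] c] [[d e] j]]. apply H.
    + intros eps He. destruct (Hcv eps He) as [N HN]. exists N. intros i Hi.
      destruct (HN i Hi) as [[[H1 (_ & _ & H2)] _] _]. simpl in H1, H2. split.
      * unfold ns_sub. now rewrite ns_opp_scal.
      * destruct H2 as (c & Hc & Hle). exists c. split; [exact Hc|].
        intros v. specialize (Hle v). simpl in Hle. unfold dsub.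
        now replace (snd (fst (fst (u i))) v - g v) with (snd (fst (fst (u i))) v + -1 * g v) by ring.
  - apply (Sl (INR n) (fun i => fst (fst (snd (u i)))) (fun i => snd (fst (u i)))).
    + exact Hf.
    + intros i. destruct (Hu i) as [[q [[_ (_ & H & _)] _]] _]. exact H.
    + intros i. destruct (Hu i) as [_ H]. destruct (u i) as [[[a b] c] [[d e] j]]. apply H.
    + intros eps He. destruct (Hcv eps He) as [N HN]. exists N. intros i Hi.
      destruct (HN i Hi) as [[_ (_ & _ & H2)] [[H1 _] _]]. simpl in H1, H2. split.
      * unfold ns_sub. now rewrite ns_opp_scal.
      * destruct H2 as (c & Hc & Hle). exists c. split; [exact Hc|].
        intros v. specialize (Hle v). simpl in Hle. unfold dsub.
        now replace (snd (fst (u i)) v - f v) with (snd (fst (u i)) v + -1 * f v) by ring.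
Qed.

Lemma sublevel_mono n m b : sublevel n b -> (n <= m)%nat -> sublevel m b.
Proof.
  intros [Hd H] Hnm. apply le_INR in Hnm. split; [exact Hd|].
  destruct b as [[[y g] f] [[x' x] k]]. destruct H as [H1 H2].
  destruct (hT y g); [|destruct H1]. destruct (hS x' f); [|destruct H2].
  simpl in *. lra.
Qed.

(** * Algebraic and topological relative interiors *)

Lemma E2_inhabited : exists z, E2 z.
Proof.
  destruct GT_RS_inhabited as (y0 & g0 & x0 & f0 & H0 & H1).
  exists ((y0, g0), f0). apply (setsub_base HV); [apply imA_Delta_zero|].
  apply coGT_coRS_domT_prS, GT_RS_coGT_coRS. exists y0, g0, f0. eauto.
Qed.

Lemma ic_eq_ri z : ic E2 z <-> ri E2 z.
Proof.
  assert (HE : forall w, E2 w -> gdom (w : gauged_Z)) by (intros; now apply inZ_gdom, E2_inZ).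
  split.
  - intros [Hcl Hicr].
    pose proof sum_difference_image as HI.
    assert (Hne : exists w, image sum_difference sublevel w) by (rewrite HI; apply E2_inhabited).
    assert (Hz : E2 z).
    { rewrite <- HI. apply icr_image_mem; [exact Hne|now rewrite HI]. }
    destruct (icr_image_interior sum_difference sum_difference_add sum_difference_scal
      sum_difference_bounded sublevel sublevel_convex sublevel_closed sublevel_mono) with (u := z)
      as (r & Hr & Hint).
    + now intros n b [H _].
    + exact Hne.
    + rewrite HI. now apply Z_closed_gclosed.
    + now rewrite HI.
    + split; [exact Hcl|split; [exact Hz|]]. exists r. split; [exact Hr|].
      intros w Hw Haff HwN. rewrite HI in Hint. apply Hint; [exact Haff|].
      apply Z_norm_gN; [apply inZ_sub; [exact Hw|now apply E2_inZ]|exact Hr|exact HwN].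
  - intros (Hcl & Hz & r & Hr & Hint). split; [exact Hcl|].
    apply (interior_icr (V := gauged_Z) E2 z r); auto.
    intros w Haff HwN. apply Hint; [|exact Haff|now apply gN_Z_norm].
    apply inZ_gdom. apply (subspace_eq _ (vadd (vsub (w : gauged_Z) z) z)).
    + apply gdom_subspace; [now exists r|auto].
    + vmod_ring.
Qed.

(** The hull inclusion may assume [aff E] closed, as [ic E] is empty otherwise; separation needs
    this. The two affine hulls then coincide, so closedness passes to [aff F]. *)
Lemma ic_mono (E F : V -> Prop) z : (exists d, E d) ->
  (forall w, E w -> F w) -> (Z_closed (aff E) -> forall w, F w -> aff E w) -> ic E z -> ic F z.
Proof.
  intros Hne HEF HFE [Hcl Hicr]. specialize (HFE Hcl). split.
  - refine (eq_ind _ Z_closed Hcl _ _).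
    apply functional_extensionality. intros w. apply propositional_extensionality. split.
    + apply (aff_subset_aff HV). intros v Hv. now apply (aff_incl HV), HEF.
    + now apply (aff_subset_aff HV).
  - now apply (icr_mono HV E).
Qed.

Lemma ic_chain :
  (forall z, ic E0 z -> ic E1 z) /\ (forall z, ic E1 z -> ic E2 z) /\
  (forall z, ic E2 z <-> ri E2 z).
Proof.
  destruct GT_RS_inhabited as (y0 & g0 & x0 & f0 & H0 & H1).
  assert (Ha : E0 ((y0, g0), f0)).
  { apply (setsub_base HV); [apply imA_Delta_zero|]. exists y0, g0, f0. eauto. }
  assert (H01 : forall z, E0 z -> E1 z) by
    (intros z; apply setsub_mono, GT_RS_coGT_coRS).
  split; [|split].
  - intros z. apply ic_mono.
    + now exists ((y0, g0), f0).
    + exact H01.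
    + intros _. exact coGT_coRS_aff.
  - intros z. apply ic_mono.
    + exists ((y0, g0), f0). now apply H01.
    + intros w. apply setsub_mono, coGT_coRS_domT_prS.
    + intros Hcl w. now apply domT_prS_aff.
  - apply ic_eq_ri.
Qed.

End Qualification.

Theorem theorem3p4 (X Y : NormedSpace)
  (HX : is_Banach X) (HY : is_Banach Y)
  (HX0 : nonzero_space X) (HY0 : nonzero_space Y)
  (S : Op X) (T : Op Y)
  (HS : is_gossez_D S) (HT : is_gossez_D T)
  (hS : X -> (X -> R) -> Rinf) (hT : Y -> (Y -> R) -> Rinf)
  (HhS : is_strong_representative S hS) (HhT : is_strong_representative T hT)
  (A : X -> Y) (HA : is_bounded_linear_map A)
  (Hne : exists z, domT_prS hS hT z /\ imA_Delta A z) :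
  (forall z, ic (setsub (GT_RS S T) (imA_Delta A)) z ->
             ic (setsub (coGT_coRS S T) (imA_Delta A)) z) /\
  (forall z, ic (setsub (coGT_coRS S T) (imA_Delta A)) z ->
             ic (setsub (domT_prS hS hT) (imA_Delta A)) z) /\
  (forall z, ic (setsub (domT_prS hS hT) (imA_Delta A)) z <->
             ri (setsub (domT_prS hS hT) (imA_Delta A)) z).
Proof.
  apply (ic_chain X Y HX HY HX0 HY0 S T HS HT hS hT (proj1 HhS) (proj1 HhT) A HA).
Qed.
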